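(* Let $\omega\in\mathcal H$ with Hodge decomposition $\omega=\partial\eta+\Theta$, $\eta\in\mathcal F$, $\Theta\in\ker\partial^\ast$, and write $\Theta=\sum_{w'}\Theta_{w'}\partial^{(|w'|+1)}\psi_{w'}$. Let $q=F_wq_i$, where $w$ is a word and $i\in\{0,1,2\}$. If $\partial_T\eta(F_wq_i)$ exists and $$\sum_{m=0}^\infty|\Theta_{wi^m}|\,5^m<\infty,$$ then the tangential part $\vec t\cdot\omega(F_wq_i)$ is well-defined and $$\vec t\cdot\omega(F_wq_i)=5^{|w|}\,\vec t\cdot(\omega\circ F_w)(q_i)=5^{|w|}\left(\partial_T(\eta\circ F_w)(q_i)+10\sum_{m=0}^\infty\Theta_{wi^m}5^m\right).$$
   Context: Gasket. Let $r=3/5$, $q_0=(1/2,\sqrt3/2)$, $q_1=(0,0)$, $q_2=(1,0)$, $F_i(x)=\frac12(x-q_i)+q_i$, and let $K\subset\mathbb R^2$ be the Sierpinski gasket (attractor of $F_0,F_1,F_2$). For a word $w=w_1\cdots w_n$ over $\{0,1,2\}$ (length $|w|=n$, empty word allowed with $F_\emptyset=\mathrm{Id}$) put $F_w=F_{w_1}\circ\dots\circ F_{w_n}$, $K_w=F_w(K)$; $i^m$ is the word consisting of $m$ letters $i$, and $wi^m$ is the concatenation; indices are mod 3. $V_0=\{q_0,q_1,q_2\}$, $V_n=\bigcup_{|w|=n}F_w(V_0)$. Write $p\sim_nq$ if $p\ne q$ in $V_n$ lie in a common $K_w$, $|w|=n$. $\mathcal E(u,v)=\lim_m r^{-m}\sum_{p\sim_mq}(u(p)-u(q))(v(p)-v(q))$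 (each edge once), $\mathcal F$ is the set of continuous $u:K\to\mathbb R$ for which these sums with $v=u$ are bounded in $m$, $\mathcal F_{V_0}=\{u\in\mathcal F: u|_{V_0}=0\}$. $h\in\mathcal F$ is harmonic if $\mathcal E(h,\varphi)=0$ for all $\varphi\in\mathcal F_{V_0}$. The energy measure $\nu_{u,v}$ is the unique finite signed Borel measure with $\nu_{u,v}(K_w)=r^{-|w|}\mathcal E(u\circ F_w,v\circ F_w)$ for all $w$. One-forms. $\mathcal H$ is the Hilbert space obtained from finite sums of symbols $f\partial u$ ($f\in C(K)$, $u\in\mathcal F$) by quotienting and completing with respect to the bilinear extension of $\langle f\partial u,g\partial v\rangle_{\mathcal H}=\int_Kfg\,d\nu_{u,v}$; bounded Borel functions act on $\mathcal H$ by multiplication; $\partial:\mathcal F\to\mathcal H$, $\partial u=1\,\partial u$. $\ker\partial^\ast=\{\omega:\langle\omega,\partial u\rangle_{\mathcal H}=0\ \forall u\in\mathcal F\}$. Hodge decomposition: $\mathcal H=\operatorname{Im}\partial\oplus\ker\partial^\ast$ (orthogonal). Loops. $P_n\mathcal F$ ($n\ge0$) is the set of families $u=\{u^{(w)}\}_{|w|=n}$, $u^{(w)}:K_w\to\mathbb R$ with $u^{(w)}\circ F_w\in\mathcal F$, and $\partial^{(n)}u=\sum_{|w|=n}\mathbf 1_{K_w}\partial\tilde u^{(w)}$ with any extension $\tilde u^{(w)}\in\mathcal F$ of $u^{(w)}$; for $n\le0$, $P_n\mathcal F=\mathcal F$ and $\partial^{(n)}=\partial$. Let $\psi\in P_1\mathcal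 F$ have representatives $\psi^{(i)}$ on $K_i$ with $\psi^{(i)}\circ F_i$ harmonic, $\psi^{(i)}(q_i)=0$, $\psi^{(i)}(F_iq_{i+1})=1$, $\psi^{(i)}(F_iq_{i+2})=-1$. For a word $w$, $\psi_w\in P_{|w|+1}\mathcal F$ equals $\psi^{(i)}\circ F_w^{-1}$ on $K_{wi}$ and $0$ on all other cells of level $|w|+1$. The family $\{\partial^{(|w|+1)}\psi_w\}_w$ is an orthogonal basis of $\ker\partial^\ast$; the coefficients of $\Theta\in\ker\partial^\ast$ in it are denoted $\Theta_w$. Composition with $F_w$. For $\omega=\partial\eta+\Theta$ (Hodge decomposition), put $\omega\circ F_w:=\partial(\eta\circ F_w)+\sum_{w'}\Theta_{w'}\partial^{(|w'|-|w|+1)}(\psi_{w'}\circ F_w)\in\mathcal H$. Tangential derivative and part. For $u\in\mathcal F$, $\partial_Tu(q_i)=\lim_{n\to\infty}5^n\big(u(F_{i^n}q_{i+1})-u(F_{i^n}q_{i+2})\big)$ if the limit exists, and $\partial_Tu(F_wq_i)=5^{|w|}\partial_T(u\circ F_w)(q_i)$. The definition is extended to piecewise functions in $P_n\mathcal F$, using the values of the representative on the small cells $K_{wi^n}$ ($n$ large) at $F_wq_i$. The tangential part of $\omega=\partial\eta+\Theta$ at $F_wq_i$ is $\vec t\cdot\omega(F_wq_i):=\partial_T\eta(F_wq_i)+\sum_{w'}\Theta_{w'}\partial_T\psi_{w'}(F_wq_i)$, defined if $\partial_T\eta(F_wq_i)$ exists and the series is absolutely convergent.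
   Formalization: The last expression as printed fails for nonempty w (η=0, Θ=∂^{(1)}ψ_∅, w=0, i=0 gives 10 versus 0); the sum over proper prefixes w' of w of Θ_{w'} ∂_T(ψ_{w'}∘F_w)(q_i) is added inside the bracket. *)

(* Defs.v *)
From HB Require Import structures.
From mathcomp Require Import all_boot all_order all_algebra.
From mathcomp Require Import all_classical all_reals all_analysis.
From mathcomp Require Import showcase.summability.

Set Implicit Arguments.
Unset Strict Implicit.
Unset Printing Implicit Defensive.

Import Order.TTheory GRing.Theory Num.Theory.
Import numFieldNormedType.Exports.

Local Open Scope classical_set_scope.
Local Open Scope ring_scope.

(* The indices 0, 1, 2 are taken mod 3: 'I_3 carries the ring structure of
   Z/3Z, so i + 1 and i + 2 below are additions mod 3. *)
Notation word := (seq 'I_3).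

Section Gasket.
Variable R : realType.

Local Notation plane := (R^o * R^o)%type.

Definition r : R := 3 / 5.

Definition q (i : 'I_3) : plane :=
  match val i with
  | 0%N => (1 / 2, Num.sqrt 3 / 2)
  | 1%N => (0, 0)
  | _ => (1, 0)
  end.

Definition F (i : 'I_3) (x : plane) : plane := (1 / 2 : R) *: (x - q i) + q i.
Definition Finv (i : 'I_3) (y : plane) : plane := (2 : R) *: (y - q i) + q i.

Definition Fw (w : word) : plane -> plane := foldr (fun i f => F i \o f) id w.
Definition Fw_inv (w : word) : plane -> plane :=
  foldr (fun i g => g \o Finv i) id w.

Definition is_attractor (K : set plane) : Prop :=
  [/\ compact K, K !=set0 & K = \bigcup_i (F i @` K)].

Definition V (n : nat) : set plane :=
  [set p | exists w : word, exists i, size w = n /\ p = Fw w (q i)].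

(* Real functions on K are represented by functions on the whole plane; every
   notion below only depends on their values on K. *)
Section Functions.
Variable K : set plane.

Definition cell (w : word) : set plane := Fw w @` K.

Definition adjacent (n : nat) (p p' : plane) : Prop :=
  [/\ V n p, V n p', p <> p' &
      exists w : word, [/\ size w = n, cell w p & cell w p']].

(* The sum runs over ordered pairs, hence the factor 1/2. *)
Definition energy_at (m : nat) (u v : plane -> R) : R :=
  r ^- m * (2^-1 * \sum_(e \in [set e : plane * plane | adjacent m e.1 e.2])
                     (u e.1 - u e.2) * (v e.1 - v e.2)).

Definition energy (u v : plane -> R) : R :=
  limn (fun m => energy_at m u v).

Definition in_C (f : plane -> R) : Prop := {within K, continuous f}.

Definition in_F (u : plane -> R) : Prop :=
  in_C u /\ exists M : R, forall m, energy_at m u u <= M.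

Definition in_F0 (u : plane -> R) : Prop := in_F u /\ forall i, u (q i) = 0.

Definition harmonic (h : plane -> R) : Prop :=
  in_F h /\ forall phi, in_F0 phi -> energy h phi = 0.

Definition borel := g_sigma_algebraType (@open plane).

Definition bounded_borel (b : plane -> R) : Prop :=
  measurable_fun (K : set borel) (b : borel -> R) /\
  exists M : R, forall x, K x -> `|b x| <= M.

(* A finite signed Borel measure on K is a charge on the Borel sets of the
   plane that vanishes outside K. *)
Definition is_energy_measure (u v : plane -> R)
    (nu : {charge set borel -> \bar R}) : Prop :=
  (forall A : set borel, measurable A -> A `&` K = set0 -> nu A = 0%E) /\
  (forall w : word,
     nu (cell w) = (r ^- size w * energy (u \o Fw w) (v \o Fw w))%:E).

Definition charge_integral (nu : {charge set borel -> \bar R})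
    (f : plane -> R) : R :=
  let P := cid (Hahn_decomposition nu) in
  let N := cid (projT2 P) in
  \int[jordan_pos (projT2 N)]_(x in (K : set borel)) f x -
  \int[jordan_neg (projT2 N)]_(x in (K : set borel)) f x.

(* The Hilbert space of one-forms, presented as a completion of the space of
   finite sums of symbols f du: a complete inner product space in which these
   sums are dense and have the prescribed inner products. This determines it
   up to a unique isometry, the bilinearity of (f, u) |-> f du included. The
   action of a bounded Borel function b is the continuous linear extension of
   f du |-> (b f) du, the form (b f) du being determined by its inner products
   with the dense set of finite sums. *)
Record one_forms := OneForms {
  form :> completeNormedModType R;
  inner : form -> form -> R;
  nu : (plane -> R) -> (plane -> R) -> {charge set borel -> \bar R};
  symbol : (plane -> R) -> (plane -> R) -> form;
  act : (plane -> R) -> form -> form;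
  inner_linear : forall (a : R) x y z,
    inner (a *: x + y) z = a * inner x z + inner y z;
  inner_sym : forall x y, inner x y = inner y x;
  inner_norm : forall x, inner x x = `|x| ^+ 2;
  nu_spec : forall u v, in_F u -> in_F v -> is_energy_measure u v (nu u v);
  inner_symbol : forall f g u v, in_C f -> in_C g -> in_F u -> in_F v ->
    inner (symbol f u) (symbol g v) =
    charge_integral (nu u v) (fun x => f x * g x);
  symbol_dense : forall (x : form) (e : R), 0 < e ->
    exists s : seq ((plane -> R) * (plane -> R)),
      (forall k, (k < size s)%N ->
         in_C (nth (cst 0, cst 0) s k).1 /\ in_F (nth (cst 0, cst 0) s k).2) /\
      `|x - \sum_(fu <- s) symbol fu.1 fu.2| < e;
  act_linear : forall b, bounded_borel b -> forall (a : R) x y,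
    act b (a *: x + y) = a *: act b x + act b y;
  act_continuous : forall b, bounded_borel b -> continuous (act b);
  act_symbol : forall b f g u v, bounded_borel b ->
    in_C f -> in_C g -> in_F u -> in_F v ->
    inner (act b (symbol f u)) (symbol g v) =
    charge_integral (nu u v) (fun x => b x * f x * g x)
}.

(* A family in P_n F assigns to each word w of length n a function whose values
   on the cell of w are the component u^(w); its values at words of other
   lengths are irrelevant, and for n = 0 the only component is at [::]. *)
Definition family := word -> plane -> R.

Definition extension (w : word) (u : plane -> R) : plane -> R :=
  xget u [set v | in_F v /\ forall x, cell w x -> v x = u x].

Definition compose_family (n : nat) (U : family) (w : word) : family :=
  fun v => U (take n (w ++ v)) \o Fw w.

Section Forms.
Variable X : one_forms.

Definition d (u : plane -> R) : X := symbol X (cst 1) u.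

Definition in_ker_dstar (om : X) : Prop :=
  forall u, in_F u -> inner om (d u) = 0.

Definition d_piecewise (n : nat) (U : family) : X :=
  if n is 0%N then d (U [::])
  else \sum_(w : n.-tuple 'I_3)
         act (\1_(cell w) : plane -> R) (d (extension w (U w))).

End Forms.

Definition is_loop_function (psi : 'I_3 -> plane -> R) : Prop :=
  forall i : 'I_3,
  [/\ harmonic (psi i \o F i), psi i (q i) = 0,
      psi i (F i (q (i + 1))) = 1 & psi i (F i (q (i + 2%:R))) = -1].

Definition dT_seq (u : plane -> R) (i : 'I_3) : nat -> R :=
  fun n => 5 ^+ n * (u (Fw (nseq n i) (q (i + 1))) -
                     u (Fw (nseq n i) (q (i + 2%:R)))).

Definition dT_exists (u : plane -> R) (w : word) (i : 'I_3) : Prop :=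
  cvgn (dT_seq (u \o Fw w) i).

(* The derivative at F_w q_i is taken inside the cell of w, so it depends on
   the pair (w, i) and not only on the point. *)
Definition dT (u : plane -> R) (w : word) (i : 'I_3) : R :=
  5 ^+ size w * limn (dT_seq (u \o Fw w) i).

(* All cells of w i^m with m >= n lie in the level n cell selected here. *)
Definition dT_piecewise (n : nat) (U : family) (w : word) (i : 'I_3) : R :=
  dT (U (take n (w ++ nseq n i))) w i.

Section Loops.
Variables (X : one_forms) (psi : 'I_3 -> plane -> R).

Definition loop (w : word) : family :=
  fun v => let i := last ord0 v in
           if v == rcons w i then psi i \o Fw_inv w else cst 0.

Definition d_loop (w : word) : X := d_piecewise X (size w).+1 (loop w).

(* om = d eta + Theta is the Hodge decomposition of om, and c is the family of
   coefficients of Theta in the orthogonal basis of the d_loop w. *)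
Definition decomposes (om : X) (eta : plane -> R) (Theta : X) (c : word -> R) :
    Prop :=
  [/\ in_F eta, in_ker_dstar Theta, om = d X eta + Theta &
      partial_sum (fun w => c w *: d_loop w) @ totally --> Theta].

(* The level |w'| + 1 - |w| is a truncated subtraction: for |w'| < |w| the
   piecewise function composed with F_w is an element of F (level 0), so that
   the summands of the proper prefixes w' of w belong, like d (eta o F_w), to
   the exact part of the composed form. *)
Definition compose_form (om : X) (w : word) : X :=
  get [set om' : X | exists eta Theta c, decomposes om eta Theta c /\
    partial_sum (fun w' => c w' *:
        d_piecewise X ((size w').+1 - size w)
          (compose_family (size w').+1 (loop w') w)) @ totally
      --> om' - d X (eta \o Fw w)].

Definition dT_loop (w' w : word) (i : 'I_3) : R :=
  dT_piecewise (size w').+1 (loop w') w i.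

Definition is_tangential_part (om : X) (w : word) (i : 'I_3) (t : R) : Prop :=
  exists eta Theta c,
  [/\ decomposes om eta Theta c, dT_exists eta w i,
      esum.summable [set: word] (fun w' => (c w' * dT_loop w' w i)%:E) &
      t = dT eta w i + sum (fun w' => c w' * dT_loop w' w i : R^o)].

Definition has_tangential_part (om : X) (w : word) (i : 'I_3) : Prop :=
  exists t, is_tangential_part om w i t.

Definition tangential_part (om : X) (w : word) (i : 'I_3) : R :=
  xget 0 [set t | is_tangential_part om w i t].

End Loops.
End Functions.
End Gasket.

(* Main.v *)
(* Composing with F_w turns the summand of Theta at w' = wv into the loop at v,
   the summands at proper prefixes of w into exact harmonic forms, and all others
   into 0. The tangential derivative at F_w q_i only sees the loops at prefixes
   of w and at the words w i^m: near q_i the latter restrict to the antisymmetric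
   harmonic function, whose differences shrink by exactly 1/5 per level, which
   gives 10 * 5^m.
   For this to be well defined, eta has to be determined up to a constant on the
   vertices and the coefficients of Theta have to be determined by Theta. The
   first follows from |d u|^2 = E(u, u), the second from the orthogonality of
   the loops. Orthogonality needs the inner products of forms cut off to cells:
   1_A du is the weak limit of g_n du for continuous g_n decreasing to 1_A, so
   <1_A du, 1_B dv> = nu_{v,u}(A /\ B), and junction points carry no mass.
   Harmonic functions are built explicitly as uniform limits of the
   2/5-2/5-1/5 rule. *)

Require Import Defs.
From mathcomp Require Import all_boot all_order all_algebra.
From mathcomp Require Import all_classical all_reals all_analysis.
From mathcomp Require Import measurable_realfun showcase.summability.
From mathcomp Require Import finmap ring lra.

Set Implicit Arguments.
Unset Strict Implicit.
Unset Printing Implicit Defensive.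

Import Order.TTheory GRing.Theory Num.Theory.
Import numFieldNormedType.Exports.

Local Open Scope classical_set_scope.
Local Open Scope ring_scope.

(** * Geometry of the gasket *)

(** The conclusion contains a finite sum over the proper prefixes of [w] that the displayed formula
    does not show. On the cell of [w] the loop at such a prefix is a single harmonic function whose
    derivative at the corner need not vanish (for [w] equal to the one letter [i] it is 2), so the
    exact part of the composed form is [eta \o Fw w] plus a combination of these functions. The
    identity between the two tangential parts comes from one evaluation formula, used at [(w, i)]
    for [om] and at [([::], i)] for the composed form. The composed form, the tangential part and
    the extensions are picked by choice from sets. This shapes the proof: each use needs a nonempty
    set and a result independent of the pick. Functions are therefore compared only at the vertices,
    whose values determine energies and tangential derivatives. *)

Lemma ord3_ind (P : 'I_3 -> Prop) : P 0 -> P 1 -> P 2%:R -> forall i, P i.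
Proof.
move=> P0 P1 P2 [[|[|[|//]]] hi].
- by rewrite (_ : Ordinal hi = 0) //; apply: val_inj.
- by rewrite (_ : Ordinal hi = 1) //; apply: val_inj.
- by rewrite (_ : Ordinal hi = 2%:R) //; apply: val_inj.
Qed.

Lemma sum_ord3 (W : nmodType) (f : 'I_3 -> W) :
  \sum_i f i = f 0 + f 1 + f 2%:R.
Proof.
rewrite 3!big_ord_recl big_ord0 addr0 addrA.
by congr (f _ + f _ + f _); apply: val_inj.
Qed.

Lemma word_compare (v w : word) :
  [\/ exists x, w = v ++ x, exists x, v = w ++ x |
      exists c j k x y, [/\ v = c ++ j :: x, w = c ++ k :: y & j != k]].
Proof.
elim: v w => [|j v IH] [|k w].
- by constructor 1; exists [::].
- by constructor 1; exists (k :: w).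
- by constructor 2; exists (j :: v).
have [<-|jk] := eqVneq j k; last by constructor 3; exists [::], j, k, v, w.
case: (IH w) => [[x ->]|[x ->]|[c [a [b [x [y [-> -> ab]]]]]]].
- by constructor 1; exists x.
- by constructor 2; exists x.
- by constructor 3; exists (j :: c), a, b, x, y.
Qed.

Lemma word_branch (v w : word) : size v = size w -> v <> w ->
  exists c j k x y, [/\ v = c ++ j :: x, w = c ++ k :: y & j != k].
Proof.
move=> svw vw; case: (word_compare v w) => [[x wE]|[x vE]|//].
- move: svw; rewrite wE size_cat => /esym /eqP.
  rewrite -{2}[size v]addn0 eqn_add2l size_eq0 => /eqP x0.
  by case: vw; rewrite wE x0 cats0.
- move: svw; rewrite vE size_cat => /eqP.
  rewrite -{2}[size w]addn0 eqn_add2l size_eq0 => /eqP x0.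
  by case: vw; rewrite vE x0 cats0.
Qed.

Section Geometry.
Variable R : realType.
Local Notation plane := (R^o * R^o)%type.
Local Notation q := (@q R).

(** In these coordinates [F j] halves every entry and adds 1/2 to entry [j], so statements about [K]
    become linear inequalities in three nonnegative numbers with sum 1. *)
Definition barycentric (i : 'I_3) (p : plane) : R :=
  match val i with
  | 0%N => 2 * p.2 / Num.sqrt 3
  | 1%N => 1 - p.1 - p.2 / Num.sqrt 3
  | _ => p.1 - p.2 / Num.sqrt 3
  end.

Local Notation lam := barycentric.

Lemma sqrt3_gt0 : 0 < Num.sqrt 3 :> R.
Proof. by rewrite sqrtr_gt0 ltr0n. Qed.

Lemma sqrt3_neq0 : Num.sqrt 3 != 0 :> R.
Proof. exact: lt0r_neq0 sqrt3_gt0. Qed.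

Lemma barycentric_q i j : lam i (q j) = (i == j)%:R.
Proof.
have s0 := sqrt3_neq0.
by move: j; apply: ord3_ind; move: i; apply: ord3_ind;
  rewrite /barycentric /= ?eqxx /=; field.
Qed.

Lemma barycentric_F i j p : lam i (F j p) = ((i == j)%:R + lam i p) / 2.
Proof.
rewrite -barycentric_q; have s0 := sqrt3_neq0; case: p => a b.
rewrite /F; case: (q j) => c d.
by move: i; apply: ord3_ind; rewrite /barycentric /= /GRing.scale /=; field.
Qed.

Lemma barycentric_sum p : lam 0 p + lam 1 p + lam 2%:R p = 1.
Proof. have s0 := sqrt3_neq0; rewrite /barycentric /=; field. exact: s0. Qed.

Lemma barycentric_inj p p' : (forall i, lam i p = lam i p') -> p = p'.
Proof.
move=> e; have s0 := sqrt3_neq0; case: p p' e => a b [c d] e.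
have := e 0; rewrite /barycentric /= => e0.
have bd : b = d.
  have : 2 * b / Num.sqrt 3 * (Num.sqrt 3 / 2) =
         2 * d / Num.sqrt 3 * (Num.sqrt 3 / 2) by rewrite e0.
  have -> : 2 * b / Num.sqrt 3 * (Num.sqrt 3 / 2) = b by field.
  by have -> : 2 * d / Num.sqrt 3 * (Num.sqrt 3 / 2) = d by field.
have : a - b / Num.sqrt 3 = c - d / Num.sqrt 3 := e 2%:R.
rewrite bd => /addIr ac.
by rewrite ac.
Qed.

Lemma barycentric_continuous i : continuous (lam i).
Proof.
have c1 : continuous (fun p : plane => p.1) by move=> p; exact: cvg_fst.
have c2 : continuous (fun p : plane => p.2) by move=> p; exact: cvg_snd.
move: i; apply: ord3_ind; rewrite /barycentric /= => p.
- by apply: cvgMl; apply: cvgMr; exact: c2.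
- apply: cvgB; first by apply: cvgB; [exact: cvg_cst|exact: c1].
  by apply: cvgMl; exact: c2.
- apply: cvgB; first exact: c1.
  by apply: cvgMl; exact: c2.
Qed.

Lemma F_K j : cancel (@F R j) (@Finv R j).
Proof.
move=> p; rewrite /F /Finv addrK scalerA.
by rewrite (_ : 2 * (1 / 2) = 1 :> R) ?scale1r ?subrK //; field.
Qed.

Lemma Finv_K j : cancel (@Finv R j) (@F R j).
Proof.
move=> p; rewrite /F /Finv addrK scalerA.
by rewrite (_ : 1 / 2 * 2 = 1 :> R) ?scale1r ?subrK //; field.
Qed.

Lemma F_continuous j : continuous (@F R j).
Proof.
move=> p; rewrite /F; apply: cvgD; last exact: cvg_cst.
apply: cvgZr; apply: cvgB; [exact: cvg_id|exact: cvg_cst].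
Qed.

Lemma Finv_continuous j : continuous (@Finv R j).
Proof.
move=> p; rewrite /Finv; apply: cvgD; last exact: cvg_cst.
apply: cvgZr; apply: cvgB; [exact: cvg_id|exact: cvg_cst].
Qed.

Lemma F_fixed j : F j (q j) = q j.
Proof.
apply: barycentric_inj => i.
rewrite barycentric_F barycentric_q; case: (i == j); lra.
Qed.

Lemma F_sym j k : F j (q k) = F k (q j).
Proof.
apply: barycentric_inj => i.
by rewrite !barycentric_F !barycentric_q addrC.
Qed.

Lemma q_inj : injective q.
Proof.
move=> i j ij; have := barycentric_q i i; rewrite eqxx ij barycentric_q.
by case: eqP => // _ /esym/eqP; rewrite oner_eq0.
Qed.

Lemma Fw_cat (v w : word) (p : plane) : Fw (v ++ w) p = Fw v (Fw w p).
Proof. by elim: v => //= i v IH; rewrite /= IH. Qed.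

Lemma Fw_rcons (w : word) j (p : plane) : Fw (rcons w j) p = Fw w (F j p).
Proof. by rewrite -cats1 Fw_cat. Qed.

Lemma Fw_K (w : word) : cancel (@Fw R w) (@Fw_inv R w).
Proof. by elim: w => //= i w IH p /=; rewrite F_K IH. Qed.

Lemma Fw_inj (w : word) : injective (@Fw R w).
Proof. exact: can_inj (Fw_K w). Qed.

Lemma Fw_inv_cat (v w : word) (p : plane) :
  Fw_inv (v ++ w) p = Fw_inv w (Fw_inv v p).
Proof. by elim: v p => //= i v IH p; rewrite /= IH. Qed.

Lemma Fw_continuous (w : word) : continuous (@Fw R w).
Proof.
elim: w => [|i w IH] p /=; first exact: cvg_id.
apply: (@continuous_comp _ _ _ (Fw w) (F i)); first exact: IH.
exact: F_continuous.
Qed.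

(** * The attractor in barycentric coordinates *)

Section Attractor.
Variable K : set plane.
Hypothesis attrK : is_attractor K.

Lemma attractor_compact : compact K. Proof. by case: attrK. Qed.

Lemma plane_hausdorff : hausdorff_space plane.
Proof. exact: norm_hausdorff. Qed.

Lemma attractor_closed : closed K.
Proof. exact: (compact_closed plane_hausdorff attractor_compact). Qed.

Lemma attractor_F j p : K p -> K (F j p).
Proof. by case: attrK => _ _ KE Kp; rewrite KE; exists j => //; exists p. Qed.

Lemma attractor_Fw w p : K p -> K (Fw w p).
Proof. by move=> Kp; elim: w => //= i w; exact: attractor_F. Qed.

Lemma attractor_split p : K p -> exists j p', K p' /\ p = F j p'.
Proof.
by case: attrK => _ _ KE; rewrite {1}KE => -[j _ [p' Kp' <-]]; exists j, p'.
Qed.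

(** The minimum of [lam i] over the compact set [K] is attained in the image of some [F j]; there it
    is at least half of itself, hence nonnegative. *)
Lemma attractor_barycentric_ge0 i p : K p -> 0 <= lam i p.
Proof.
case: attrK => cK K0 _ Kp.
have clam : {within K, continuous (lam i)}.
  by apply: continuous_subspaceT; exact: barycentric_continuous.
have [m /set_mem Km mmin] := compact_EVT_min K0 cK clam.
apply: le_trans (mmin p (mem_set Kp)).
have [j [m' [Km' mE]]] := attractor_split Km.
have := mmin m' (mem_set Km'); have := congr1 (lam i) mE.
by rewrite barycentric_F; case: (i == j) => /=; lra.
Qed.

Lemma attractor_barycentric_eq1 i p : K p -> 1 <= lam i p -> p = q i.
Proof.
move=> Kp; have := attractor_barycentric_ge0 _ Kp; move: i.
have := barycentric_sum p => S; apply: ord3_ind => l0 l1;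
  (have := l0 0; have := l0 1; have := l0 2%:R => h2 h1 h0);
  apply: barycentric_inj; apply: ord3_ind; rewrite barycentric_q /=; lra.
Qed.

(** Where [lam i] is largest on [K], applying [F i] moves it halfway towards 1 without leaving [K];
    so the maximum is at least 1, and only [q i] has such a coordinate. *)
Lemma attractor_q i : K (q i).
Proof.
case: attrK => cK K0 _.
have clam : {within K, continuous (fun p => - lam i p)}.
  apply: continuous_subspaceT => p; apply: cvgN.
  exact: barycentric_continuous.
have [m /set_mem Km mmin] := compact_EVT_min K0 cK clam.
rewrite -(@attractor_barycentric_eq1 i m) //.
have := mmin (F i m) (mem_set (attractor_F i Km)).
rewrite barycentric_F eqxx /=; lra.
Qed.

(** Coordinate [j] is at least 1/2 on the left side and half of [lam j p'] on the right, which
    forces [lam j p'] up to 1; coordinate [k] is symmetric. *)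
Lemma attractor_junction j k p p' : j != k -> K p -> K p' ->
  F j p = F k p' -> p = q k /\ p' = q j.
Proof.
move=> jk Kp Kp' e.
have ej : 1 <= lam j p'.
  have := congr1 (lam j) e; rewrite !barycentric_F eqxx (negbTE jk) /=.
  have := attractor_barycentric_ge0 j Kp; lra.
have ek : 1 <= lam k p.
  have := congr1 (lam k) e; rewrite !barycentric_F eqxx eq_sym (negbTE jk) /=.
  have := attractor_barycentric_ge0 k Kp'; lra.
by rewrite (attractor_barycentric_eq1 Kp ek) (attractor_barycentric_eq1 Kp' ej).
Qed.

(** A map [F i] with [i] different from [j] leaves coordinate [j] at most 1/2, so it cannot reach
    [q j]; and [F j] reaches it only from a point with coordinate 1. *)
Lemma attractor_corner w j p : K p -> Fw w p = q j -> p = q j.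
Proof.
move=> Kp; elim: w => //= i w IH e.
have KF := attractor_Fw w Kp.
have : 1 <= lam j (Fw w p).
  have := congr1 (lam j) e.
  rewrite barycentric_F barycentric_q eqxx.
  have := attractor_barycentric_ge0 j KF.
  case: eqP => [->|ji] /=; first lra.
  have l1 : lam j (Fw w p) <= 1.
    have := barycentric_sum (Fw w p).
    have := attractor_barycentric_ge0 0 KF.
    have := attractor_barycentric_ge0 1 KF.
    have := attractor_barycentric_ge0 2%:R KF.
    by move: j {e ji IH}; apply: ord3_ind; lra.
  lra.
by move/(attractor_barycentric_eq1 KF); exact: IH.
Qed.

(** Stripping the common prefix [c] leaves a junction of two first-level cells; [attractor_corner]
    then carries its corners through the tails [x] and [y]. *)
Lemma attractor_branch c j k x y p p' : j != k -> K p -> K p' ->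
  Fw (c ++ j :: x) p = Fw (c ++ k :: y) p' ->
  [/\ p = q k, p' = q j & Fw (c ++ j :: x) p = Fw (rcons c j) (q k)].
Proof.
move=> jk Kp Kp'; rewrite !Fw_cat => /Fw_inj /= e.
have [e1 e2] := attractor_junction jk (attractor_Fw x Kp) (attractor_Fw y Kp') e.
split; first exact: (attractor_corner Kp e1).
  exact: (attractor_corner Kp' e2).
by rewrite e1 Fw_rcons.
Qed.

End Attractor.
End Geometry.

(** * Energy *)

Lemma sum_tuple_cons (W : nmodType) n (f : word -> W) :
  \sum_(w : n.+1.-tuple 'I_3) f w =
  \sum_i \sum_(w : n.-tuple 'I_3) f (i :: w).
Proof.
rewrite pair_big /=.
rewrite (reindex (fun p : 'I_3 * n.-tuple 'I_3 => [tuple of p.1 :: p.2])) /=.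
  by [].
exists (fun t : n.+1.-tuple 'I_3 => (thead t, [tuple of behead t])).
- by move=> [i t] _ /=; congr pair; apply: val_inj.
- by move=> t _ /=; rewrite [t in RHS]tuple_eta; apply: val_inj.
Qed.

Section Energy.
Variable R : realType.
Local Notation plane := (R^o * R^o)%type.
Local Notation q := (@q R).
Local Notation r := (r R).

Definition triangle_energy (x y : 'I_3 -> R) : R :=
  \sum_i (x i - x (i + 1)) * (y i - y (i + 1)).

Definition corners (u : plane -> R) (i : 'I_3) : R := u (q i).

(** Recursion over the first letter turns additivity, monotonicity and the harmonic identities into
    one-step inductions; [energy_atE] identifies the result with the sum over edges. *)
Fixpoint graph_energy (n : nat) (u v : plane -> R) : R :=
  if n is m.+1 then r^-1 * \sum_j graph_energy m (u \o F j) (v \o F j)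
  else triangle_energy (corners u) (corners v).

Local Notation E := graph_energy.

Lemma r_gt0 : 0 < r. Proof. by rewrite /Defs.r; lra. Qed.

Lemma r_neq0 : r != 0. Proof. exact: lt0r_neq0 r_gt0. Qed.

Lemma rV_ge0 : 0 <= r^-1. Proof. by rewrite invr_ge0 ltW ?r_gt0. Qed.

Lemma triangle_energyE (x y : 'I_3 -> R) :
  triangle_energy x y =
    (x 0 - x 1) * (y 0 - y 1) + (x 1 - x 2%:R) * (y 1 - y 2%:R) +
    (x 2%:R - x 0) * (y 2%:R - y 0).
Proof.
rewrite /triangle_energy sum_ord3.
have -> : 0 + 1 = 1 :> 'I_3 by apply: val_inj.
have -> : 1 + 1 = 2%:R :> 'I_3 by apply: val_inj.
by have -> : 2%:R + 1 = 0 :> 'I_3 by apply: val_inj.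
Qed.

Lemma triangle_energy_pairs (x y : 'I_3 -> R) :
  2^-1 * \sum_(p : 'I_3 * 'I_3 | p.1 != p.2)
    (x p.1 - x p.2) * (y p.1 - y p.2) = triangle_energy x y.
Proof.
rewrite big_mkcond /= -(pair_big xpredT xpredT (fun i j =>
  if i != j then (x i - x j) * (y i - y j) else 0)) /=.
by rewrite !sum_ord3 /= triangle_energyE; field.
Qed.

(* The difference of the two sides is 5/3 times the energy of the deviation of
   the midpoint values from the harmonic extension. *)
Lemma triangle_energy_le (X : 'I_3 -> 'I_3 -> R) : (forall j k, X j k = X k j) ->
  triangle_energy (fun i => X i i) (fun i => X i i) <=
  r^-1 * \sum_j triangle_energy (X j) (X j).
Proof.
move=> Xs; rewrite sum_ord3 !triangle_energyE /Defs.r.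
rewrite (Xs 1 0) (Xs 2%:R 0) (Xs 2%:R 1).
set a := X 0 0; set b := X 1 1; set c := X 2%:R 2%:R.
set z := X 0 1; set y := X 0 2%:R; set x := X 1 2%:R.
rewrite -subr_ge0.
pose xi := x - (2 * b + 2 * c + a) / 5.
pose eta := y - (2 * a + 2 * c + b) / 5.
pose zeta := z - (2 * a + 2 * b + c) / 5.
rewrite [leRHS](_ : _ = 5 / 3 * (2 * xi ^+ 2 + 2 * eta ^+ 2 + 2 * zeta ^+ 2 +
   (xi - eta) ^+ 2 + (eta - zeta) ^+ 2 + (zeta - xi) ^+ 2)); last first.
  by rewrite /xi /eta /zeta; field.
apply: mulr_ge0; first lra.
by do ![exact: sqr_ge0|exact: ler0n|apply: addr_ge0|apply: mulr_ge0].
Qed.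

Lemma graph_energy_le n u : E n u u <= E n.+1 u u.
Proof.
elim: n u => [|n IH] u; last first.
  rewrite ler_wpM2l ?rV_ge0 //; apply: ler_sum => j _; exact: IH.
have Fc : (fun i => u (F i (q i))) = corners u.
  by apply/funext => i; rewrite F_fixed.
have := @triangle_energy_le (fun j k => u (F j (q k)))
  (fun j k => congr1 u (F_sym R j k)).
by rewrite Fc.
Qed.

Lemma graph_energy_nondecreasing u : nondecreasing_seq (fun n => E n u u).
Proof. by apply/nondecreasing_seqP => n; exact: graph_energy_le. Qed.

Lemma graph_energy_sym n u v : E n u v = E n v u.
Proof.
elim: n u v => [|n IH] u v /=.
  by rewrite !triangle_energyE; ring.
by congr (_ * _); apply: eq_bigr => j _.
Qed.

Lemma graph_energy_linear n a u v w :
  E n (fun p => a * u p + v p) w = a * E n u w + E n v w.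
Proof.
elim: n u v w => [|n IH] u v w /=.
  by rewrite !triangle_energyE /corners; ring.
rewrite mulrCA -mulrDr [a * _]mulr_sumr -big_split /=.
by congr (_ * _); apply: eq_bigr => j _; exact: IH.
Qed.

Lemma triangle_energy_ge0 x : 0 <= triangle_energy x x.
Proof.
rewrite triangle_energyE.
by do ![rewrite -expr2; exact: sqr_ge0|apply: addr_ge0].
Qed.

Lemma triangle_energy_eq0 x : triangle_energy x x = 0 -> forall i, x i = x 0.
Proof.
rewrite triangle_energyE => e.
have s0 := sqr_ge0 (x 0 - x 1); have s1 := sqr_ge0 (x 1 - x 2%:R).
have s2 := sqr_ge0 (x 2%:R - x 0).
have x10 : (x 0 - x 1) ^+ 2 = 0 by lra.
have x20 : (x 2%:R - x 0) ^+ 2 = 0 by lra.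
have {}x10 : x 0 = x 1 by apply/eqP; rewrite -subr_eq0 -sqrf_eq0 x10.
have {}x20 : x 2%:R = x 0 by apply/eqP; rewrite -subr_eq0 -sqrf_eq0 x20.
exact: ord3_ind.
Qed.

Lemma graph_energy_ge0 n u : 0 <= E n u u.
Proof.
elim: n u => [|n IH] u /=; first exact: triangle_energy_ge0.
by rewrite mulr_ge0 ?rV_ge0 // sumr_ge0.
Qed.

Lemma graph_energy_tuples n u v :
  E n u v = r ^- n * \sum_(w : n.-tuple 'I_3)
    triangle_energy (corners (u \o Fw w)) (corners (v \o Fw w)).
Proof.
elim: n u v => [|n IH] u v.
  rewrite /= expr0 invr1 mul1r (big_pred1 [tuple]) //= => t.
  by apply/esym/eqP; exact: tuple0.
have /= -> := sum_tuple_cons n (fun w : word =>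
  triangle_energy (corners (u \o Fw w)) (corners (v \o Fw w))).
rewrite exprS (invfM r (r ^+ n)) -(mulrA r^-1) /=.
congr (_ * _); rewrite mulr_sumr; apply: eq_bigr => j _; exact: IH.
Qed.

(* The energy and the tangential derivatives only see the values at the points
   of the graphs V_n. *)
Definition eq_vertices (u u' : plane -> R) : Prop :=
  forall (w : word) i, u (Fw w (q i)) = u' (Fw w (q i)).

Lemma eq_vertices_F u u' j : eq_vertices u u' ->
  eq_vertices (u \o F j) (u' \o F j).
Proof. by move=> e w i; exact: (e (j :: w)). Qed.

Lemma graph_energy_eq n u u' v v' : eq_vertices u u' -> eq_vertices v v' ->
  E n u v = E n u' v'.
Proof.
elim: n u u' v v' => [|n IH] u u' v v' eu ev /=.
  congr triangle_energy; apply/funext => i; first exact: (eu [::] i).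
  exact: (ev [::] i).
by congr (_ * _); apply: eq_bigr => j _; apply: IH; exact: eq_vertices_F.
Qed.

(** The summand of each cell vanishes as well, so by induction [u] is constant on the vertices of
    every first-level cell; the constants agree because [F j] fixes [q j]. *)
Lemma graph_energy0_eq_vertices u : (forall n, E n u u = 0) ->
  eq_vertices u (cst (u (q 0))).
Proof.
move=> E0 w; elim: w u E0 => [|j w IH] u E0 i /=.
  exact: (triangle_energy_eq0 (E0 0%N)).
have Ej n : E n (u \o F j) (u \o F j) = 0.
  apply/eqP; rewrite eq_le graph_energy_ge0 andbT.
  have /eqP := E0 n.+1; rewrite /= mulf_eq0 invr_eq0 (negbTE r_neq0) /=.
  rewrite psumr_eq0 => [/allP /(_ j)|l _]; last exact: graph_energy_ge0.
  by rewrite mem_index_enum => /(_ isT) /eqP ->.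
have := IH _ Ej i; rewrite /= => ->.
have /(_ j) := triangle_energy_eq0 (Ej 0%N).
have /(_ j) := triangle_energy_eq0 (E0 0%N).
by rewrite /corners /= F_fixed => <- <-.
Qed.

Lemma graph_energy_cst n a v : E n (cst a) v = 0.
Proof.
elim: n v => [|n IH] v /=; last by rewrite big1 ?mulr0.
by rewrite triangle_energyE /corners /cst /= !subrr !mul0r !addr0.
Qed.

Section OnAttractor.
Variable K : set plane.
Hypothesis attrK : is_attractor K.

Local Notation adj n p p' := (Defs.adjacent K n p p').

(** An edge determines its cell and the ordered pair of corners, because two distinct cells of one
    level share at most one point. *)
Lemma edges_bij n : set_bij
  [set x : n.-tuple 'I_3 * ('I_3 * 'I_3) | x.2.1 != x.2.2]
  [set e : plane * plane | adj n e.1 e.2]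
  (fun x => (Fw x.1 (q x.2.1), Fw x.1 (q x.2.2))).
Proof.
have Kq := attractor_q attrK.
split.
- move=> [w [i j]] /= ij; split => /=.
  + by exists (w : word), i; rewrite size_tuple.
  + by exists (w : word), j; rewrite size_tuple.
  + by move=> /Fw_inj /q_inj /eqP; rewrite (negbTE ij).
  + exists (w : word); rewrite size_tuple; split => //.
      by exists (q i).
    by exists (q j).
- move=> [w [i j]] [v [k l]] /set_mem /= ij /set_mem /= kl [] e1 e2.
  have [wv|/eqP wv] := eqVneq (w : word) (v : word).
    rewrite wv in e1 e2; move/Fw_inj/q_inj : e1 => ->.
    move/Fw_inj/q_inj : e2 => ->.
    by rewrite (val_inj wv : w = v).
  have [|c [a [b [x [y [wE vE ab]]]]]] := word_branch _ wv.
    by rewrite !size_tuple.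
  rewrite wE vE in e1 e2.
  have [f1 _ _] := attractor_branch attrK ab (Kq i) (Kq k) e1.
  have [f2 _ _] := attractor_branch attrK ab (Kq j) (Kq l) e2.
  by move: ij; rewrite (q_inj f1) (q_inj f2) eqxx.
- move=> [p p'] [/= [v [k [sv pE]]] [v' [k' [sv' p'E]]] pp' [w [sw cp cp']]].
  have vertex v0 k0 : size v0 = n -> cell K w (Fw v0 (q k0)) ->
      exists i, Fw v0 (q k0) = Fw w (q i).
    move=> sv0 [z Kz e]; have [<-|/eqP vw] := eqVneq v0 w; first by exists k0.
    have [|c [a [b [x [y [vE wE ab]]]]]] := word_branch _ vw.
      by rewrite sv0 sw.
    rewrite vE wE in e *.
    have [_ zE _] := attractor_branch attrK ab (Kq k0) Kz (esym e).
    by exists a; rewrite -zE e.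
  rewrite pE in cp; rewrite p'E in cp'.
  have [i ei] := vertex _ _ sv cp; have [j ej] := vertex _ _ sv' cp'.
  exists (Tuple (introT eqP sw), (i, j)) => /=; last by rewrite -ei -ej pE p'E.
  by apply: contra_notN pp' => /eqP ij; rewrite pE p'E ei ej ij.
Qed.

Lemma energy_atE n u v : energy_at K n u v = E n u v.
Proof.
rewrite graph_energy_tuples /energy_at; congr (_ * _).
rewrite (reindex_fsbig _ _ _ _ (edges_bij n)) /=.
have -> : [set x : n.-tuple 'I_3 * ('I_3 * 'I_3) | x.2.1 != x.2.2] =
  [set` [pred x : n.-tuple 'I_3 * ('I_3 * 'I_3) | x.2.1 != x.2.2]] by [].
rewrite -(@bigfs _ _ _ _ (index_enum _)) ?index_enum_uniq //; last first.
  by move=> x _; rewrite mem_index_enum.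
rewrite -(pair_big_dep xpredT (fun _ x => x.1 != x.2) (fun (w : n.-tuple 'I_3) x =>
  (u (Fw w (q x.1)) - u (Fw w (q x.2))) *
  (v (Fw w (q x.1)) - v (Fw w (q x.2))))) /=.
rewrite mulr_sumr; apply: eq_bigr => w _.
exact: (triangle_energy_pairs (corners (u \o Fw w)) (corners (v \o Fw w))).
Qed.

End OnAttractor.
End Energy.

(** * Finite energy and the limit form *)

Section FiniteEnergy.
Variable R : realType.
Local Notation plane := (R^o * R^o)%type.
Local Notation q := (@q R).
Local Notation r := (r R).
Local Notation E := (@graph_energy R).
Variable K : set plane.
Hypothesis attrK : is_attractor K.
Implicit Types u v w : plane -> R.

Lemma within_continuous_precomp (A B : set plane) (f : plane -> R)
    (g : plane -> plane) : (forall p, B p -> A (g p)) -> continuous g ->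
  {within A, continuous f} -> {within B, continuous (f \o g)}.
Proof.
move=> BA cg /subspace_continuousP cf; apply/subspace_continuousP => p Bp.
apply: (@cvg_comp _ _ _ g f (within B (nbhs p)) (within A (nbhs (g p)))).
  move=> U; rewrite /within /= => AU.
  have := cg p _ AU; rewrite /= nbhs_simpl /=.
  by apply: filterS => y /= + By; apply; exact: BA.
exact: cf (BA _ Bp).
Qed.

Lemma in_C_continuous (f : plane -> R) : continuous f -> in_C K f.
Proof. exact: continuous_subspaceT. Qed.

Lemma in_C_cst a : in_C K (cst a).
Proof. by apply: in_C_continuous => p; exact: cvg_cst. Qed.

Lemma in_C_linear a (f g : plane -> R) : in_C K f -> in_C K g ->
  in_C K (fun p => a * f p + g p).
Proof.
move=> /subspace_continuousP cf /subspace_continuousP cg.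
apply/subspace_continuousP => p Kp.
by apply: cvgD; [apply: cvgMr; exact: cf|exact: cg].
Qed.

Lemma in_C_F j (f : plane -> R) : in_C K f -> in_C K (f \o F j).
Proof.
apply: within_continuous_precomp; last exact: F_continuous.
by move=> p; exact: attractor_F.
Qed.

Lemma in_FE u :
  in_F K u <-> in_C K u /\ exists M : R, forall n, E n u u <= M.
Proof.
split=> -[cu [M uM]]; split=> //; exists M => n.
  by rewrite -(energy_atE attrK).
by rewrite (energy_atE attrK).
Qed.

Lemma in_F_C u : in_F K u -> in_C K u. Proof. by case. Qed.

Lemma graph_energy_linearr n a u v w :
  E n w (fun p => a * u p + v p) = a * E n w u + E n w v.
Proof.
by rewrite graph_energy_sym graph_energy_linear !(graph_energy_sym _ _ w).
Qed.

Lemma in_F_cst a : in_F K (cst a).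
Proof.
apply/in_FE; split; first exact: in_C_cst.
by exists 0 => n; rewrite graph_energy_cst.
Qed.

Lemma in_F_linear a u v : in_F K u -> in_F K v ->
  in_F K (fun p => a * u p + v p).
Proof.
move=> /in_FE[cu [M uM]] /in_FE[cv [N vN]]; apply/in_FE.
split; first exact: in_C_linear.
(* Parallelogram law: the energies of [a u + v] and [- a u + v] add up to 2 a^2 E(u, u) + 2 E(v, v),
   and the second one is nonnegative. *)
exists (2 * a ^+ 2 * M + 2 * N) => n.
have := graph_energy_ge0 n (fun p => (- a) * u p + v p).
rewrite !graph_energy_linear !graph_energy_linearr (graph_energy_sym n v u).
have : a ^+ 2 * E n u u <= a ^+ 2 * M by rewrite ler_wpM2l ?sqr_ge0.
by have := vN n; rewrite !expr2; lra.
Qed.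

Lemma in_F_F j u : in_F K u -> in_F K (u \o F j).
Proof.
move=> /in_FE[cu [M uM]]; apply/in_FE; split; first exact: in_C_F.
exists (r * M) => n; have := uM n.+1.
rewrite /= -ler_pdivlMl ?invr_gt0 ?r_gt0 // invrK; apply: le_trans.
rewrite (bigD1 j) //= lerDl sumr_ge0 // => k _; exact: graph_energy_ge0.
Qed.

Lemma in_F_Fw (w : word) u : in_F K u -> in_F K (u \o Fw w).
Proof.
elim: w u => [|j w IH] u uF; first by [].
by have := IH _ (in_F_F j uF).
Qed.

(** Monotonicity gives the limit only on the diagonal; polarization with [u + v] and [v - u] gives
    the rest. *)
Lemma graph_energy_cvg u v : in_F K u -> in_F K v ->
  cvgn (fun n => E n u v).
Proof.
move=> uF vF.
have cv w : in_F K w -> cvgn (fun n => E n w w).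
  move=> /in_FE[_ [M wM]]; apply: nondecreasing_is_cvgn.
    exact: graph_energy_nondecreasing.
  by exists M => _ [n _ <-].
have cp := cv _ (in_F_linear 1 uF vF).
have cm := cv _ (in_F_linear (-1) uF vF).
rewrite (_ : (fun n => E n u v) = (fun n => 4^-1 *
  (E n (fun p => 1 * u p + v p) (fun p => 1 * u p + v p) -
   E n (fun p => -1 * u p + v p) (fun p => -1 * u p + v p)))); last first.
  apply/funext => n; rewrite !graph_energy_linear !graph_energy_linearr.
  by rewrite (graph_energy_sym n v u); field.
by apply: is_cvgMr; apply: is_cvgB.
Qed.

Lemma energyE u v : energy K u v = limn (fun n => E n u v).
Proof. by congr (limn _); apply/funext => n; rewrite (energy_atE attrK). Qed.

Lemma energy_cvg u v : in_F K u -> in_F K v ->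
  (fun n => E n u v) @ \oo --> energy K u v.
Proof. by move=> uF vF; rewrite energyE; exact: graph_energy_cvg. Qed.

Lemma energyP u v l : (fun n => E n u v) @ \oo --> l -> energy K u v = l.
Proof. by move=> ul; rewrite energyE; exact: cvg_lim ul. Qed.

Lemma energy_sym u v : energy K u v = energy K v u.
Proof.
by rewrite !energyE; congr (limn _); apply/funext => n; exact: graph_energy_sym.
Qed.

Lemma energy_linear a u v w : in_F K u -> in_F K v -> in_F K w ->
  energy K (fun p => a * u p + v p) w = a * energy K u w + energy K v w.
Proof.
move=> uF vF wF; apply: energyP.
under eq_fun do rewrite graph_energy_linear.
by apply: cvgD; [apply: cvgMr|]; exact: energy_cvg.
Qed.

Lemma energy_linearr a u v w : in_F K u -> in_F K v -> in_F K w ->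
  energy K w (fun p => a * u p + v p) = a * energy K w u + energy K w v.
Proof. by move=> uF vF wF; rewrite energy_sym energy_linear // !(energy_sym w). Qed.

Lemma energy_ge n u : in_F K u -> E n u u <= energy K u u.
Proof.
move=> uF; rewrite energyE.
apply: (nondecreasing_cvgn_le (@graph_energy_nondecreasing _ u)).
exact: graph_energy_cvg.
Qed.

Lemma energy_ge0 u : in_F K u -> 0 <= energy K u u.
Proof. by move=> uF; apply: le_trans (energy_ge 0 uF); exact: graph_energy_ge0. Qed.

Lemma energy_eq u u' v v' : eq_vertices u u' -> eq_vertices v v' ->
  energy K u v = energy K u' v'.
Proof.
move=> uu' vv'; rewrite !energyE; congr (limn _); apply/funext => n.
exact: graph_energy_eq.
Qed.

Lemma energy_cst a v : energy K (cst a) v = 0.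
Proof.
apply: energyP; under eq_fun do rewrite graph_energy_cst.
exact: cvg_cst.
Qed.

Lemma energy_split u v : in_F K u -> in_F K v ->
  energy K u v = r^-1 * \sum_j energy K (u \o F j) (v \o F j).
Proof.
move=> uF vF; apply: energyP; rewrite -cvg_shiftS /=.
apply: cvgMr; rewrite sum_ord3.
under eq_fun do rewrite sum_ord3.
by apply: cvgD; [apply: cvgD|]; apply: energy_cvg; exact: in_F_F.
Qed.

Lemma energy0_eq_vertices u : in_F K u -> energy K u u = 0 ->
  eq_vertices u (cst (u (q 0))).
Proof.
move=> uF u0; apply: graph_energy0_eq_vertices => n.
by apply/eqP; rewrite eq_le graph_energy_ge0 andbT -u0 energy_ge.
Qed.

End FiniteEnergy.

(** * Gluing and harmonic functions *)

Section Gluing.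
Variable R : realType.
Local Notation plane := (R^o * R^o)%type.
Local Notation q := (@q R).
Local Notation r := (r R).
Local Notation E := (@graph_energy R).
Local Notation lam := (@barycentric R).
Variable K : set plane.
Hypothesis attrK : is_attractor K.

Definition compatible (u : 'I_3 -> plane -> R) : Prop :=
  forall j k, u j (q k) = u k (q j).

(** At a junction the first of the cells 0, 1, 2 containing the point decides; [compatible] says
    that the other one would give the same value. *)
Definition glue (u : 'I_3 -> plane -> R) (p : plane) : R :=
  if pselect (K (Finv 0 p)) then u 0 (Finv 0 p)
  else if pselect (K (Finv 1 p)) then u 1 (Finv 1 p)
  else u 2%:R (Finv 2%:R p).

Lemma glue_F u j p : compatible u -> K p -> glue u (F j p) = u j p.
Proof.
move=> uc Kp.
have other k : K (Finv k (F j p)) -> u k (Finv k (F j p)) = u j p.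
  move=> Kk; have [->|kj] := eqVneq k j; first by rewrite F_K.
  have e : F k (Finv k (F j p)) = F j p by rewrite Finv_K.
  by have [-> ->] := attractor_junction attrK kj Kk Kp e.
rewrite /glue; case: pselect => [/other //|n0].
case: pselect => [/other //|n1].
apply: other; move: j n0 n1; apply: ord3_ind; rewrite F_K => n0 n1 //;
  by [case: n0|case: n1].
Qed.

Lemma eq_vertices_K (u v : plane -> R) : (forall p, K p -> u p = v p) ->
  eq_vertices u v.
Proof.
by move=> uv w i; apply: uv; apply: attractor_Fw => //; exact: attractor_q.
Qed.

Lemma in_C_glue u : compatible u -> (forall j, in_C K (u j)) ->
  in_C K (glue u).
Proof.
move=> uc uC.
have closedF j : closed (F j @` K).
  apply: (compact_closed (@plane_hausdorff R)); apply: continuous_compact.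
    by apply: continuous_subspaceT; exact: F_continuous.
  exact: attractor_compact.
have KE : K = F 0 @` K `|` F 1 @` K `|` F 2%:R @` K.
  apply/seteqP; split=> p.
    move=> /(attractor_split attrK)[j [p' [Kp' ->]]].
    move: j; apply: ord3_ind; [left; left|left; right|right];
      by exists p'.
  by case=> [[]|] [p' Kp' <-]; exact: attractor_F.
have cj j : {within F j @` K, continuous (glue u)}.
  apply: (@subspace_eq_continuous plane (F j @` K) R (u j \o Finv j)).
    by move=> _ /set_mem[p Kp <-]; rewrite /= F_K; exact/esym/glue_F.
  have FK p : (F j @` K) p -> K (Finv j p) by move=> [p' Kp' <-]; rewrite F_K.
  exact: (@within_continuous_precomp _ K _ _ _ FK (@Finv_continuous R j) (uC j)).
suff : {within F 0 @` K `|` F 1 @` K `|` F 2%:R @` K, continuous (glue u)}.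
  by rewrite -KE.
apply: withinU_continuous => //; first exact: closedU.
exact: withinU_continuous.
Qed.

Lemma in_F_glue u : compatible u -> (forall j, in_F K (u j)) ->
  in_F K (glue u).
Proof.
move=> uc uF; apply/(in_FE attrK); split.
  by apply: in_C_glue => // j; exact: in_F_C.
(* The first term bounds level 0, where the function is not yet seen cell by cell; the second bounds
   all later levels. *)
exists (E 0 (glue u) (glue u) + r^-1 * \sum_j energy K (u j) (u j)).
case=> [|n].
  rewrite lerDl mulr_ge0 ?rV_ge0 ?sumr_ge0 // => j _; exact: energy_ge0.
apply: ler_wpDl; first exact: (graph_energy_ge0 0).
rewrite /= ler_wpM2l ?rV_ge0 //; apply: ler_sum => j _.
have e : eq_vertices (glue u \o F j) (u j).
  by apply: eq_vertices_K => p Kp /=; rewrite glue_F.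
by rewrite (graph_energy_eq n e e); exact: energy_ge.
Qed.

(* The 2/5-2/5-1/5 rule: x j and x k are counted twice. *)
Definition harmonic_rule (x : 'I_3 -> R) (j k : 'I_3) : R :=
  if j == k then x j else (x 0 + x 1 + x 2%:R + x j + x k) / 5.

Lemma harmonic_rule_sym x j k : harmonic_rule x j k = harmonic_rule x k j.
Proof.
rewrite /harmonic_rule eq_sym; case: eqP => [->//|_].
by congr (_ / _); rewrite -!addrA; congr (_ + (_ + (_ + _))); rewrite addrC.
Qed.

(** On each cell of level [n] this is the affine interpolation of the values that [n] rounds of the
    rule produce at its corners. *)
Fixpoint harmonic_approx (n : nat) (x : 'I_3 -> R) : plane -> R :=
  if n is m.+1 then glue (fun j => harmonic_approx m (harmonic_rule x j))
  else fun p => x 0 * lam 0 p + x 1 * lam 1 p + x 2%:R * lam 2%:R p.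

Lemma harmonic_approx_q n x i : harmonic_approx n x (q i) = x i.
Proof.
elim: n x i => [|n IH] x i /=.
  rewrite !barycentric_q; move: i.
  by apply: ord3_ind; rewrite /= ?mulr1 ?mulr0 ?addr0 ?add0r.
rewrite -F_fixed glue_F; last exact: attractor_q.
  by rewrite IH /harmonic_rule eqxx.
by move=> j k; rewrite !IH harmonic_rule_sym.
Qed.

Lemma harmonic_approx_compatible n x :
  compatible (fun j => harmonic_approx n (harmonic_rule x j)).
Proof. by move=> j k; rewrite !harmonic_approx_q harmonic_rule_sym. Qed.

Lemma harmonic_approx_F n x j p : K p ->
  harmonic_approx n.+1 x (F j p) = harmonic_approx n (harmonic_rule x j) p.
Proof. by move=> Kp; rewrite /= glue_F //; exact: harmonic_approx_compatible. Qed.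

Lemma harmonic_approx_C n x : in_C K (harmonic_approx n x).
Proof.
elim: n x => [|n IH] x /=; last first.
  apply: in_C_glue => [|j]; [exact: harmonic_approx_compatible|exact: IH].
apply: in_C_continuous => p.
by apply: cvgD; [apply: cvgD|]; apply: cvgMr; exact: barycentric_continuous.
Qed.

(** The corner value [x j] differs from a new value by (2 d + d') / 5 with two old differences d,
    d', and the two new values differ by a fifth of an old difference. *)
Lemma harmonic_rule_osc x (D : R) j : (forall i k, `|x i - x k| <= D) ->
  forall i k, `|harmonic_rule x j i - harmonic_rule x j k| <= 3 / 5 * D.
Proof.
move=> xD.
have := xD 0 1; have := xD 1 2%:R; have := xD 2%:R 0.
rewrite !ler_norml => /andP[a1 a2] /andP[b1 b2] /andP[c1 c2].
move: j; apply: ord3_ind; apply: ord3_ind; apply: ord3_ind;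
  rewrite /harmonic_rule /=; rewrite ?subrr ?normr0 ?ler_norml; try lra.
Qed.

(** By [harmonic_approx_F] the step at level [n] is a step at level 0 on a cell whose corner values
    oscillate by at most (3/5)^n D. *)
Lemma harmonic_approx_step n x (D : R) p : (forall i k, `|x i - x k| <= D) -> K p ->
  `|harmonic_approx n.+1 x p - harmonic_approx n x p| <= (3 / 5) ^+ n * D.
Proof.
elim: n x D p => [|n IH] x D p xD Kp;
  have [j [p' [Kp' ->]]] := attractor_split attrK Kp; last first.
  rewrite !harmonic_approx_F // exprSr -mulrA; apply: IH => //.
  exact: harmonic_rule_osc.
rewrite harmonic_approx_F // expr0 mul1r /= !barycentric_F.
have l0 := attractor_barycentric_ge0 attrK 0 Kp'.
have l1 := attractor_barycentric_ge0 attrK 1 Kp'.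
have l2 := attractor_barycentric_ge0 attrK 2%:R Kp'.
have D0 : 0 <= D by apply: le_trans (xD 0 0).
have S := barycentric_sum p'.
have := xD 0 1; have := xD 1 2%:R; have := xD 2%:R 0.
rewrite !ler_norml => /andP[a1 a2] /andP[b1 b2] /andP[c1 c2].
(* At the point [F j (q i)] this compares the rule with the affine interpolation, whose value there
   is the mean of [x i] and [x j]. The step is the average of these deviations with the coordinates
   of [p'] as weights. *)
pose dev i := harmonic_rule x j i - (x i + x j) / 2.
have devD i : - D <= dev i <= D.
  rewrite /dev; clear dev; move: j i; apply: ord3_ind; apply: ord3_ind;
    rewrite /harmonic_rule /=; apply/andP; split; lra.
have dE : harmonic_rule x j 0 * lam 0 p' + harmonic_rule x j 1 * lam 1 p' +
    harmonic_rule x j 2%:R * lam 2%:R p' -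
    (x 0 * (((0 == j)%:R + lam 0 p') / 2) +
     x 1 * (((1 == j)%:R + lam 1 p') / 2) +
     x 2%:R * (((2%:R == j)%:R + lam 2%:R p') / 2)) =
    dev 0 * lam 0 p' + dev 1 * lam 1 p' + dev 2%:R * lam 2%:R p'.
  have -> : lam 0 p' = 1 - lam 1 p' - lam 2%:R p' by lra.
  rewrite /dev; clear dev devD; move: j; apply: ord3_ind;
    rewrite /harmonic_rule /=; by field.
rewrite dE.
have bnd i : 0 <= lam i p' -> - D * lam i p' <= dev i * lam i p' <= D * lam i p'.
  by move=> li; have /andP[? ?] := devD i; rewrite !ler_wpM2r.
have /andP[? ?] := bnd 0 l0; have /andP[? ?] := bnd 1 l1.
have /andP[? ?] := bnd 2%:R l2.
have DE : D = D * lam 0 p' + D * lam 1 p' + D * lam 2%:R p'.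
  by rewrite -!mulrDr S mulr1.
by apply/andP; split; lra.
Qed.

(** With t the remaining tail of the geometric series (5/2 is 1 / (1 - 3/5)), [a - t] increases,
    [a + t] decreases and their gap tends to 0. *)
Lemma geometric_cvg (a : nat -> R) (c : R) :
  (forall n, `|a n.+1 - a n| <= (3 / 5) ^+ n * c) ->
  cvgn a /\ forall n, `|limn a - a n| <= 5 / 2 * ((3 / 5) ^+ n * c).
Proof.
move=> ac; pose t n : R := 5 / 2 * ((3 / 5) ^+ n * c).
have tS n : t n - t n.+1 = (3 / 5) ^+ n * c by rewrite /t exprS; field.
have t0 : t @ \oo --> (0 : R).
  have -> : t = geometric (5 / 2 * c) (3 / 5).
    by apply/funext => n; rewrite /t /geometric /=; ring.
  by apply: cvg_geometric; rewrite ger0_norm; lra.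
pose lo n := a n - t n; pose hi n := a n + t n.
have step n : lo n <= lo n.+1 /\ hi n.+1 <= hi n.
  rewrite /lo /hi; have := ac n; rewrite -tS ler_norml => /andP[? ?].
  by split; lra.
have lo_nd : nondecreasing_seq lo.
  by apply/nondecreasing_seqP => n; case: (step n).
have hi_ni : nonincreasing_seq hi.
  by apply/nonincreasing_seqP => n; case: (step n).
have hilo : hi - lo @ \oo --> (0 : R).
  have -> : hi - lo = t + t by apply/funext => n; rewrite !fctE /hi /lo; ring.
  by rewrite -[0]addr0; apply: cvgD.
have [lim_eq clo chi] := adjacent_seq lo_nd hi_ni hilo.
have ca : a @ \oo --> limn lo.
  have -> : a = lo + t by apply/funext => n; rewrite !fctE /lo; ring.
  by rewrite -[limn lo]addr0; apply: cvgD.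
split; first by apply/cvg_ex; exists (limn lo).
move=> n; rewrite (cvg_lim _ ca) // ler_norml.
have := nondecreasing_cvgn_le lo_nd clo n.
have := nonincreasing_cvgn_ge hi_ni chi n.
by rewrite lim_eq /lo /hi -/(t n) => ? ?; apply/andP; split; lra.
Qed.

Definition harmonic_extension (x : 'I_3 -> R) (p : plane) : R :=
  limn (fun n => harmonic_approx n x p).

Local Notation H := harmonic_extension.

Lemma harmonic_osc (x : 'I_3 -> R) : exists D, forall i k, `|x i - x k| <= D.
Proof.
exists (\sum_i \sum_k `|x i - x k|) => i k.
rewrite (bigD1 i) //= (bigD1 k) //= -addrA lerDl addr_ge0 //.
  by apply: sumr_ge0.
by apply: sumr_ge0 => j _; apply: sumr_ge0.
Qed.

Lemma harmonic_extension_cvg x : exists D : R, forall p, K p ->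
  cvgn (fun n => harmonic_approx n x p) /\ forall n,
  `|H x p - harmonic_approx n x p| <= 5 / 2 * ((3 / 5) ^+ n * D).
Proof.
have [D xD] := harmonic_osc x; exists D => p Kp; apply: geometric_cvg => n.
exact: harmonic_approx_step.
Qed.

Lemma harmonic_extension_q x i : H x (q i) = x i.
Proof.
rewrite /H; under eq_fun do rewrite harmonic_approx_q.
exact: lim_cst.
Qed.

Lemma harmonic_extension_F x j p : K p -> H x (F j p) = H (harmonic_rule x j) p.
Proof.
move=> Kp; have [D /(_ p Kp)[c _]] := harmonic_extension_cvg (harmonic_rule x j).
apply: cvg_lim => //; rewrite -cvg_shiftS.
rewrite (_ : (fun n => _) = (fun n => harmonic_approx n (harmonic_rule x j) p)).
  exact: c.
by apply/funext => n; exact: harmonic_approx_F.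
Qed.

Lemma harmonic_extension_C x : in_C K (H x).
Proof.
have [D HD] := harmonic_extension_cvg x.
apply/subspace_continuousP => p Kp; apply/cvgrPdist_le => e e0.
have t0 : (fun n => 5 / 2 * ((3 / 5) ^+ n * D)) @ \oo --> (0 : R).
  have -> : (fun n => 5 / 2 * ((3 / 5) ^+ n * D)) =
      geometric (5 / 2 * D) (3 / 5 : R).
    by apply/funext => n; rewrite /geometric /=; ring.
  by apply: cvg_geometric; rewrite ger0_norm; lra.
have e3 : 0 < e / 3 by lra.
have /cvgrPdist_le /(_ _ e3)[n _ /(_ n (leqnn n))] := t0.
rewrite sub0r normrN => /(le_trans (ler_norm _)) tn.
have /subspace_continuousP /(_ p Kp) := @harmonic_approx_C n x.
move=> /cvgrPdist_le /(_ _ e3); rewrite !near_withinE.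
apply: filterS => p' /= /[swap] Kp' /(_ Kp') cn.
have [_ /(_ n) hp] := HD p Kp; have [_ /(_ n) hp'] := HD p' Kp'.
move: cn hp hp'; rewrite /from_subspace !ler_norml.
move=> /andP[? ?] /andP[? ?] /andP[? ?].
by apply/andP; split; lra.
Qed.

(** The values of the rule at the junctions balance those of their neighbours, so the junction
    values of [y] cancel; the weight 5/3 makes the remaining corner terms match. *)
Lemma harmonic_rule_energy x (y : 'I_3 -> 'I_3 -> R) :
  (forall j k, y j k = y k j) ->
  r^-1 * \sum_j triangle_energy (harmonic_rule x j) (y j) =
  triangle_energy x (fun i => y i i).
Proof.
move=> ys; rewrite sum_ord3 !triangle_energyE /harmonic_rule /Defs.r /=.
by rewrite (ys 1 0) (ys 2%:R 0) (ys 2%:R 1); field.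
Qed.

Lemma harmonic_graph_energy n x v :
  E n (H x) v = triangle_energy x (corners v).
Proof.
elim: n x v => [|n IH] x v.
  congr triangle_energy; apply/funext => i; exact: harmonic_extension_q.
rewrite /= -[RHS](_ : triangle_energy x (fun i => v (F i (q i))) = _).
  rewrite -(@harmonic_rule_energy x (fun j k => v (F j (q k)))).
    congr (_ * _); apply: eq_bigr => j _.
    have e : eq_vertices (H x \o F j) (H (harmonic_rule x j)).
      by apply: eq_vertices_K => p Kp /=; exact: harmonic_extension_F.
    by rewrite (graph_energy_eq n e (fun _ _ => erefl)) IH.
  by move=> j k; rewrite F_sym.
by congr triangle_energy; apply/funext => i; rewrite F_fixed.
Qed.

Lemma harmonic_extension_in_F x : in_F K (H x).
Proof.
apply/(in_FE attrK); split; first exact: harmonic_extension_C.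
exists (triangle_energy x (corners (H x))) => n.
by rewrite harmonic_graph_energy.
Qed.

Lemma harmonic_extension_energy x v :
  energy K (H x) v = triangle_energy x (corners v).
Proof.
rewrite (energyE attrK); under eq_fun do rewrite harmonic_graph_energy.
exact: lim_cst.
Qed.

(** The difference of [h] and the explicit extension vanishes at the three corners. It is orthogonal
    in energy to [h] by harmonicity and to the extension by the corner formula, so its energy is
    zero. *)
Lemma harmonic_eq_vertices h : Defs.harmonic K h ->
  eq_vertices h (H (corners h)).
Proof.
move=> [hF hharm].
have HF := harmonic_extension_in_F (corners h).
pose g p := -1 * H (corners h) p + h p.
have gF : in_F K g by exact: in_F_linear.
have gq i : g (q i) = 0 by rewrite /g harmonic_extension_q /corners; ring.
have gg : energy K g g = 0.
  rewrite {1}/g energy_linear // hharm; last by split.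
  rewrite harmonic_extension_energy triangle_energyE /corners !gq; ring.
move=> w i; have := energy0_eq_vertices attrK gF gg w i.
by rewrite /cst gq /g => /eqP; rewrite mulN1r addrC subr_eq0 => /eqP.
Qed.

Lemma harmonic_energy h v : Defs.harmonic K h ->
  energy K h v = triangle_energy (corners h) (corners v).
Proof.
move=> /harmonic_eq_vertices hH; rewrite -harmonic_extension_energy.
exact: energy_eq.
Qed.

Lemma harmonic_Fw h (w : word) : Defs.harmonic K h ->
  exists x, eq_vertices (h \o Fw w) (H x).
Proof.
move=> /harmonic_eq_vertices; move: (corners h) => x.
elim: w h x => [|j w IH] h x hH; first by exists x.
apply: (IH (h \o F j) (harmonic_rule x j)) => v i.
rewrite (eq_vertices_F j hH) /= harmonic_extension_F //.
by apply: attractor_Fw => //; exact: attractor_q.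
Qed.

(** On the cell at corner [i] the rule gives the other two corners values whose difference is a
    fifth of the old one; the factor 5 cancels this at every level. *)
Lemma harmonic_extension_dT x i n : dT_seq (H x) i n = x (i + 1) - x (i + 2%:R).
Proof.
rewrite /dT_seq; elim: n x => [|n IH] x.
  by rewrite expr0 mul1r /= !harmonic_extension_q.
have Kv k : K (Fw (nseq n i) (q k)).
  by apply: attractor_Fw => //; exact: attractor_q.
rewrite /= !harmonic_extension_F // exprS -mulrA IH.
by move: i {IH Kv}; apply: ord3_ind; rewrite /harmonic_rule /=; field.
Qed.

Lemma eq_vertices_dT_seq (u u' : plane -> R) (i : 'I_3) : eq_vertices u u' ->
  dT_seq u i = dT_seq u' i.
Proof. by move=> uu'; apply/funext => n; rewrite /dT_seq !uu'. Qed.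

(** The function is continued letter by letter, by harmonic functions on the two other cells. This
    shows that [extension] never falls back on its default. *)
Lemma extension_exists (w : word) u : in_F K (u \o Fw w) ->
  exists v, in_F K v /\ forall p, cell K w p -> v p = u p.
Proof.
elim: w u => [|j w IH] u uF; first by exists u.
have [v [vF vu]] := IH (u \o F j) uF.
(* On a cell [k] other than [j], corner [j] is the junction with the cell of [j], where the value is
   prescribed; the other corners get 0. *)
pose y k l := if l == j then v (q k) else 0.
pose g k := if k == j then v else H (y k).
have gc : compatible g.
  have off k l : k != j -> g k (q l) = y k l.
    by move=> kj; rewrite /g (negbTE kj) harmonic_extension_q.
  move=> k l; have [->|kj] := eqVneq k j; have [->|lj] := eqVneq l j => //.
  - by rewrite (off l j) // /g /y !eqxx.
  - by rewrite (off k j) // /g /y !eqxx.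
  - by rewrite !off // /y (negbTE kj) (negbTE lj).
exists (glue g); split.
  apply: in_F_glue => // k; rewrite /g; case: ifP => // _.
  exact: harmonic_extension_in_F.
move=> _ [p Kp <-] /=; rewrite glue_F //; last exact: attractor_Fw.
by rewrite /g eqxx vu //; exists p.
Qed.

Lemma extensionP (w : word) u : in_F K (u \o Fw w) ->
  in_F K (extension K w u) /\ forall p, cell K w p -> extension K w u p = u p.
Proof. by move=> /extension_exists ex; exact: (xgetPex u ex). Qed.

End Gluing.

(** * Forms cut off to cells *)

Section ChargeIntegral.
Variable R : realType.
Local Notation plane := (R^o * R^o)%type.
Local Notation borel := (borel R).
Variable K : set plane.
Hypothesis closedK : closed K.

Lemma measurable_closed (A : set plane) : closed A -> measurable (A : set borel).
Proof.
move=> cA; rewrite -(setCK A); apply: measurableC.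
by apply: sub_sigma_algebra; exact: closed_openC.
Qed.

Lemma in_C_measurable (f : plane -> R) : in_C K f ->
  measurable_fun (K : set borel) (f : borel -> R).
Proof.
move=> /continuousP cf.
apply: (measurability _ (RGenOpens.measurableE R)).
move=> _ [_ [a [b ->] <-]].
have oab : open (`]a, b[%classic : set R) by exact: interval_open.
have /open_subspaceP[V oV VD] := cf _ oab.
rewrite setIC -VD; apply: measurableI; last exact: measurable_closed.
exact: sub_sigma_algebra.
Qed.

Lemma indic_measurable (A : set plane) : closed A ->
  measurable_fun (K : set borel) (\1_A : borel -> R).
Proof.
by move=> cA; apply: measurable_funTS; apply: measurable_indic;
  exact: measurable_closed.
Qed.

Lemma Rintegral_cvg_bounded (mu : {finite_measure set borel -> \bar R})
    (f_ : nat -> plane -> R) (f : plane -> R) (M : R) :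
  (forall n, measurable_fun (K : set borel) (f_ n : borel -> R)) ->
  measurable_fun (K : set borel) (f : borel -> R) ->
  (forall n p, K p -> `|f_ n p| <= M) ->
  (forall p, K p -> f_ ^~ p @ \oo --> f p) ->
  (fun n => \int[mu]_(p in (K : set borel)) f_ n p) @ \oo -->
  \int[mu]_(p in (K : set borel)) f p.
Proof.
move=> mf_ mf f_M f_f.
have mK := measurable_closed closedK.
have iM : mu.-integrable (K : set borel) (EFin \o cst M).
  exact: finite_measure_integrable_cst.
have [] := @dominated_convergence _ _ _ mu (K : set borel) mK
  (fun n => EFin \o (f_ n : borel -> R)) (EFin \o (f : borel -> R))
  (EFin \o cst M).
- by move=> n; apply/measurable_EFinP; exact: mf_.
- exact/measurable_EFinP.
- by apply: aeW => p Kp; apply: cvg_EFin; [exact: nearW|exact: f_f].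
- exact: iM.
- by apply: aeW => p n Kp; rewrite lee_fin; exact: f_M.
move=> fi _ cv.
by apply: fine_cvg; rewrite fineK //; exact: integrable_fin_num fi.
Qed.

Implicit Types nu : {charge set borel -> \bar R}.

Lemma charge_integral_cvg nu (f_ : nat -> plane -> R) (f : plane -> R) (M : R) :
  (forall n, measurable_fun (K : set borel) (f_ n : borel -> R)) ->
  measurable_fun (K : set borel) (f : borel -> R) ->
  (forall n p, K p -> `|f_ n p| <= M) ->
  (forall p, K p -> f_ ^~ p @ \oo --> f p) ->
  (fun n => charge_integral K nu (f_ n)) @ \oo --> charge_integral K nu f.
Proof.
move=> mf_ mf f_M f_f; rewrite /charge_integral.
by apply: cvgB; apply: (@Rintegral_cvg_bounded _ _ _ M).
Qed.

Lemma eq_charge_integral nu (f g : plane -> R) :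
  (forall p, K p -> f p = g p) -> charge_integral K nu f = charge_integral K nu g.
Proof.
move=> fg; rewrite /charge_integral.
by congr (_ - _); apply: eq_Rintegral => p /set_mem; exact: fg.
Qed.

Lemma charge_integral_indic nu (A : set plane) : closed A -> A `<=` K ->
  charge_integral K nu (\1_A) = fine (nu A).
Proof.
move=> cA AK; have mA := measurable_closed cA.
have mK := measurable_closed closedK.
rewrite /charge_integral; set P := cid _; set N := cid _.
have -> : nu A = (jordan_pos (projT2 N) A - jordan_neg (projT2 N) A)%E.
  by rewrite (jordan_decomp (projT2 N) mA) /cadd /= cscaleN1.
rewrite /Rintegral !integral_indic // fineB ?fin_num_measure //.
by rewrite !setIidl.
Qed.

End ChargeIntegral.

(** * Inner products and weak limits *)

Section InnerProduct.
Variable R : realType.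
Local Notation plane := (R^o * R^o)%type.
Variables (K : set plane) (X : one_forms K).
Implicit Types x y z : X.

Lemma innerDl x y z : inner (x + y) z = inner x z + inner y z.
Proof. by have := inner_linear 1 x y z; rewrite scale1r mul1r. Qed.

Lemma inner0l z : inner (0 : X) z = 0.
Proof.
have := innerDl 0 0 z; rewrite addr0 => /esym/eqP.
by rewrite -subr_eq0 addrK => /eqP.
Qed.

Lemma innerZl a x z : inner (a *: x) z = a * inner x z.
Proof. by have := inner_linear a x 0 z; rewrite addr0 inner0l addr0. Qed.

Lemma innerNl x z : inner (- x) z = - inner x z.
Proof. by rewrite -scaleN1r innerZl mulN1r. Qed.

Lemma innerBl x y z : inner (x - y) z = inner x z - inner y z.
Proof. by rewrite innerDl innerNl. Qed.

Lemma innerDr x y z : inner z (x + y) = inner z x + inner z y.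
Proof. by rewrite inner_sym innerDl !(inner_sym _ z). Qed.

Lemma inner0r z : inner z (0 : X) = 0.
Proof. by rewrite inner_sym inner0l. Qed.

Lemma innerZr a x z : inner z (a *: x) = a * inner z x.
Proof. by rewrite inner_sym innerZl (inner_sym _ z). Qed.

Lemma innerBr x y z : inner z (x - y) = inner z x - inner z y.
Proof. by rewrite inner_sym innerBl !(inner_sym _ z). Qed.

Lemma inner_suml I (s : seq I) (P : pred I) (f : I -> X) z :
  inner (\sum_(i <- s | P i) f i) z = \sum_(i <- s | P i) inner (f i) z.
Proof.
elim: s => [|i s IH]; first by rewrite !big_nil inner0l.
by rewrite !big_cons; case: (P i); rewrite ?innerDl IH.
Qed.

Lemma inner_sumr I (s : seq I) (P : pred I) (f : I -> X) z :
  inner z (\sum_(i <- s | P i) f i) = \sum_(i <- s | P i) inner z (f i).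
Proof.
by rewrite inner_sym inner_suml; apply: eq_bigr => i _; exact: inner_sym.
Qed.

Lemma inner_ge0 x : 0 <= inner x x.
Proof. by rewrite inner_norm sqr_ge0. Qed.

Lemma inner_eq0 x : inner x x = 0 -> x = 0.
Proof.
by rewrite inner_norm => /eqP; rewrite sqrf_eq0 normr_eq0 => /eqP.
Qed.

Lemma inner_le x y : `|inner x y| <= `|x| * `|y|.
Proof.
have [->|y0] := eqVneq y 0; first by rewrite inner0r !normr0 mulr0.
have yy : 0 < inner y y by rewrite inner_norm exprn_gt0 // normr_gt0.
(* This is the component of [x] orthogonal to [y], scaled by <y, y> to avoid a division. *)
have := inner_ge0 (inner y y *: x - inner x y *: y).
rewrite innerBl !innerBr !innerZl !innerZr (inner_sym y x).
set a := inner x x; set b := inner x y; set c := inner y y in yy * => H.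
have {}H : b ^+ 2 <= a * c.
  rewrite -(ler_pM2l yy); move: H; rewrite expr2; lra.
rewrite -(@ler_pXn2r _ 2) ?nnegrE ?mulr_ge0 //.
by rewrite exprMn -!inner_norm -/a -/c real_normK ?num_real.
Qed.

Lemma inner_cvg (T : Type) (G : set_system T) {FG : Filter G} (f : T -> X) x y :
  f @ G --> x -> (fun t => inner (f t) y) @ G --> inner x y.
Proof.
move=> /cvgrPdist_lt fx; apply/cvgrPdist_lt => e e0.
have n0 : 0 < `|y| + 1 by rewrite ltr_pwDr.
have := fx _ (divr_gt0 e0 n0); apply: filterS => t ft.
rewrite -innerBl; apply: le_lt_trans (inner_le _ _) _.
rewrite ltr_pdivlMr // in ft; apply: le_lt_trans ft.
by rewrite ler_wpM2l // lerDl.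
Qed.

(* Finite sums of symbols are enough because they are dense. *)
Lemma inner_weak_cvg (x_ : nat -> X) x y (C : R) : (forall n, `|x_ n| <= C) ->
  (forall g u, in_C K g -> in_F K u ->
    (fun n => inner (x_ n) (symbol X g u)) @ \oo --> inner x (symbol X g u)) ->
  (fun n => inner (x_ n) y) @ \oo --> inner x y.
Proof.
move=> xC xw; apply/cvgrPdist_lt => e e0.
have C0 : 0 <= C by apply: le_trans (xC 0%N).
pose D := `|x| + C + 1.
have D0 : 0 < D by rewrite /D ltr_pwDr // addr_ge0.
have De : 0 < e / 2 / D by rewrite !divr_gt0.
have [s [sP sy]] := symbol_dense y De.
set y' := \sum_(fu <- s) _ in sy.
have y'w : (fun n => inner (x_ n) y') @ \oo --> inner x y'.
  rewrite /y' (big_nth (cst 0, cst 0)) big_mkord inner_sumr.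
  under eq_fun do rewrite inner_sumr.
  apply: cvg_big => [|k _]; first exact: add_continuous.
  have [gC uF] := sP k (ltn_ord k).
  exact: xw.
have e2 : 0 < e / 2 by rewrite divr_gt0.
move/cvgrPdist_lt : y'w => /(_ _ e2); apply: filterS => n xn.
have -> : inner x y - inner (x_ n) y =
    inner (x - x_ n) (y - y') + (inner x y' - inner (x_ n) y').
  rewrite innerBl !innerBr; ring.
apply: le_lt_trans (ler_normD _ _) _.
have -> : e = e / 2 + e / 2 by field.
apply: ler_ltD xn; apply: le_trans (inner_le _ _) _.
apply: le_trans (_ : D * (e / 2 / D) <= _); last first.
  by rewrite mulrC divfK ?lt0r_neq0.
apply: ler_pM => //; last exact: ltW.
apply: le_trans (ler_normB _ _) _.
by rewrite /D -addrA lerD2l; apply: le_trans (xC n) _; rewrite lerDl.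
Qed.

End InnerProduct.

(** * Continuous approximation of indicator functions *)

Section Distance.
Variable R : realType.
Local Notation plane := (R^o * R^o)%type.
Variable A : set plane.
Hypothesis A0 : A !=set0.

Definition distance (x : plane) : R := inf [set `|x - a| | a in A].

Lemma distance_lbound x : has_lbound [set `|x - a| | a in A].
Proof. by exists 0 => _ [a _ <-]. Qed.

Lemma distance_nonempty x : [set `|x - a| | a in A] !=set0.
Proof. by have [a Aa] := A0; exists `|x - a|; exists a. Qed.

Lemma distance_ge0 x : 0 <= distance x.
Proof. by apply: lb_le_inf; [exact: distance_nonempty|move=> _ [a _ <-]]. Qed.

Lemma distance_triangle x y : distance x <= `|x - y| + distance y.
Proof.
rewrite -lerBlDl; apply: lb_le_inf; first exact: distance_nonempty.
move=> _ [a Aa <-]; rewrite lerBlDl.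
apply: (@le_trans _ _ `|x - a|).
  by apply: ge_inf; [exact: distance_lbound|exists a].
by rewrite -(subrKA y); exact: ler_normD.
Qed.

Lemma distance_continuous : continuous distance.
Proof.
move=> x; apply/cvgrPdist_lt => e e0; near=> y.
apply: (@le_lt_trans _ _ `|x - y|); last first.
  by near: y; apply: cvgr_dist_lt.
rewrite ler_norml; apply/andP; split.
  by have := distance_triangle y x; rewrite distrC; lra.
by have := distance_triangle x y; lra.
Unshelve. all: by end_near. Qed.

Lemma distance_eq0 x : A x -> distance x = 0.
Proof.
move=> Ax; apply/eqP; rewrite eq_le distance_ge0 andbT.
by apply: ge_inf; [exact: distance_lbound|exists x => //; rewrite subrr normr0].
Qed.

Lemma distance_gt0 x : closed A -> ~ A x -> 0 < distance x.
Proof.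
move=> cA nAx; rewrite lt_neqAle distance_ge0 andbT eq_sym.
apply: contra_notN nAx => /eqP dx; apply: cA => U /nbhs_ballP[e e0 eU].
have [_ [a Aa <-] ae] := inf_adherent e0
    (conj (distance_nonempty x) (distance_lbound x)).
rewrite -/(distance x) dx add0r in ae.
exists a; split => //; apply: eU.
by rewrite -ball_normE.
Qed.

(** Powers of a continuous function that is 1 on [A] and below 1 off its closure: continuous,
    bounded by 1, and convergent to the indicator of a closed [A]. *)
Definition bump (n : nat) (x : plane) : R := (1 + distance x)^-1 ^+ n.

Lemma bump_base x : 0 < 1 + distance x.
Proof. by rewrite ltr_pwDl // distance_ge0. Qed.

Lemma bump_continuous n : continuous (bump n).
Proof.
move=> x; rewrite /continuous_at /bump.
have cb : (fun y => (1 + distance y)^-1) @ x --> (1 + distance x)^-1.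
  apply: cvgV; first exact: lt0r_neq0 (bump_base x).
  by apply: cvgD; [exact: cvg_cst|exact: distance_continuous].
elim: n => [|n IH]; first by under eq_fun do rewrite expr0; exact: cvg_cst.
rewrite exprS; under eq_fun do rewrite exprS.
exact: cvgM.
Qed.

Lemma bump_norm_le1 n x : `|bump n x| <= 1.
Proof.
have b0 := bump_base x; have v0 : 0 <= (1 + distance x)^-1.
  by rewrite invr_ge0 ltW.
rewrite /bump ger0_norm ?exprn_ge0 //; apply: exprn_ile1 => //.
by rewrite invf_le1 // lerDl distance_ge0.
Qed.

Lemma bump_cvg x : closed A -> bump ^~ x @ \oo --> (\1_A x : R).
Proof.
move=> cA; rewrite indicE; have [/set_mem Ax|/negP nAx] := boolP (x \in A).
  under eq_fun do rewrite /bump distance_eq0 // addr0 invr1 expr1n.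
  exact: cvg_cst.
have d0 : 0 < distance x by apply: distance_gt0 => // /mem_set.
have b0 := bump_base x.
apply: cvg_expr; rewrite ger0_norm ?invr_ge0 ?ltW //.
by rewrite invf_lt1 // ltrDl.
Qed.

End Distance.

(** * Indicators acting on exact forms *)

Section Action.
Variable R : realType.
Local Notation plane := (R^o * R^o)%type.
Local Notation r := (r R).
Local Notation borel := (borel R).
Variables (K : set plane) (X : one_forms K).
Hypothesis attrK : is_attractor K.

Let closedK : closed K := attractor_closed attrK.

Lemma in_C_bounded (f : plane -> R) : in_C K f ->
  exists M, forall p, K p -> `|f p| <= M.
Proof.
move=> cf.
have /compact_bounded[M [_ /(_ (M + 1))]] :=
  continuous_compact cf (attractor_compact attrK).
rewrite ltrDl ltr01 => /(_ isT) MP; exists (M + 1) => p Kp.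
by apply: MP; exists p.
Qed.

Lemma indic_bounded_borel (A : set plane) : closed A ->
  bounded_borel K (\1_A : plane -> R).
Proof.
move=> cA; split; first exact: indic_measurable.
by exists 1 => p _; rewrite indicE; case: (p \in A); rewrite ?normr1 ?normr0.
Qed.

Lemma energy_measureE u v (w : word) : in_F K u -> in_F K v ->
  nu X u v (cell K w) = (r ^- size w * energy K (u \o Fw w) (v \o Fw w))%:E.
Proof. by move=> uF vF; case: (nu_spec X uF vF). Qed.

Lemma inner_d u v : in_F K u -> in_F K v ->
  inner (d X u) (d X v) = energy K u v.
Proof.
move=> uF vF; rewrite inner_symbol //; try exact: in_C_cst.
have cellK : cell K [::] = K by rewrite /cell /= image_id.
have KE : charge_integral K (nu X u v) (\1_K) = fine (nu X u v K).
  exact: charge_integral_indic.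
rewrite (@eq_charge_integral _ _ _ _ (\1_K)); last first.
  by move=> p Kp; rewrite indicE mem_set // mul1r.
rewrite KE -{2}cellK energy_measureE //=.
by rewrite expr0 invr1 mul1r.
Qed.

(** Linearity of [symbol] is not a field of [one_forms]; it follows because the defect has squared
    norm zero by bilinearity of the energy. *)
Lemma d_linear a u v : in_F K u -> in_F K v ->
  d X (fun p => a * u p + v p) = a *: d X u + d X v.
Proof.
move=> uF vF; apply/eqP; rewrite -subr_eq0; apply/eqP; apply: inner_eq0.
have wF := in_F_linear attrK a uF vF.
rewrite !(innerBl, innerBr, innerDl, innerDr, innerZl, innerZr) !inner_d //.
rewrite !(energy_linear, energy_linearr) // (energy_sym attrK v u); ring.
Qed.

Lemma d_eq u v : in_F K u -> in_F K v -> eq_vertices u v -> d X u = d X v.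
Proof.
move=> uF vF uv; apply/eqP; rewrite -subr_eq0; apply/eqP; apply: inner_eq0.
rewrite innerBl !innerBr !inner_d //.
by rewrite !(energy_eq attrK uv uv, energy_eq attrK uv (fun _ _ => erefl),
  energy_eq attrK (fun _ _ => erefl) uv) !subrr.
Qed.

Section Bump.
Variable A : set plane.
Hypotheses (cA : closed A) (AK : A `<=` K) (A0 : A !=set0).

Let g n := bump A n.

Let g_C n : in_C K (g n).
Proof. by apply: in_C_continuous; exact: bump_continuous. Qed.

Let bump_integral_cvg (mu : {charge set borel -> \bar R}) (f : plane -> R)
    (M : R) : measurable_fun (K : set borel) (f : borel -> R) ->
  (forall p, K p -> `|f p| <= M) ->
  (fun n => charge_integral K mu (fun p => g n p * f p)) @ \oo -->
  charge_integral K mu (fun p => \1_A p * f p).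
Proof.
move=> mf fM; apply: (@charge_integral_cvg _ _ _ _ _ _ M).
- exact: closedK.
- by move=> n; apply: measurable_funM => //; exact: in_C_measurable.
- by apply: measurable_funM => //; exact: indic_measurable.
- move=> n p Kp; rewrite normrM -[M]mul1r ler_pM //; last exact: fM.
  exact: bump_norm_le1.
- by move=> p _; apply: cvgMl; exact: bump_cvg.
Qed.

(** Against a symbol both sides are charge integrals and dominated convergence applies; density
    extends this to all [y] once the norms are bounded. *)
Lemma inner_act_cvg u y : in_F K u ->
  (fun n => inner (symbol X (g n) u) y) @ \oo --> inner (act \1_A (d X u)) y.
Proof.
move=> uF.
have bA := indic_bounded_borel cA.
have mg n : measurable_fun (K : set borel) (g n : borel -> R).
  exact: in_C_measurable.
have [C gC] : exists C, forall n, `|symbol X (g n) u| <= C.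
  have sq : (fun n => inner (symbol X (g n) u) (symbol X (g n) u)) @ \oo -->
      charge_integral K (nu X u u) (fun p => \1_A p * \1_A p).
    under eq_fun do rewrite inner_symbol //.
    apply: (@charge_integral_cvg _ _ _ _ _ _ 1) => //.
    - by move=> n; apply: measurable_funM; exact: mg.
    - by apply: measurable_funM; exact: indic_measurable.
    - move=> n p _; rewrite normrM -[1]mul1r ler_pM //; exact: bump_norm_le1.
    - by move=> p _; apply: cvgM; exact: bump_cvg.
  have [M [_ /(_ (M + 1))]] := cvg_seq_bounded (cvgP _ sq).
  (* The squared norms are at most [M + 1], which is at most the square of [M + 2] because it is
     nonnegative. *)
  rewrite ltrDl ltr01 => /(_ isT) MP; exists (M + 1 + 1) => n.
  have /= := MP n I; rewrite inner_norm normrX normr_id => h.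
  rewrite -(@ler_pXn2r _ 2) ?nnegrE //; last first.
    have : 0 <= `|symbol X (g n) u| ^+ 2 by exact: sqr_ge0.
    by move=> h'; have := le_trans h' h; lra.
  have : 0 <= `|symbol X (g n) u| ^+ 2 by exact: sqr_ge0.
  move=> h'; have M1 := le_trans h' h; rewrite [leRHS]expr2.
  apply: le_trans h _; nra.
apply: (@inner_weak_cvg _ _ _ _ _ _ C) => // f v fC vF.
rewrite act_symbol //; last exact: in_C_cst.
have [M fM] := in_C_bounded fC.
rewrite (@eq_charge_integral _ _ _ _ (fun p => \1_A p * f p)); last first.
  by move=> p _; rewrite mulr1.
under eq_fun do rewrite inner_symbol //.
by apply: (@bump_integral_cvg _ _ M) => //; exact: in_C_measurable.
Qed.

(** [act_symbol] evaluates an acted form only against a symbol. Approximating the first factor by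
    symbols leaves one indicator acting; symmetry then brings it to the left, which exchanges [u]
    and [v]. *)
Lemma inner_act (B : set plane) u v : closed B -> B `<=` K ->
  in_F K u -> in_F K v ->
  inner (act \1_A (d X u)) (act \1_B (d X v)) = fine (nu X v u (A `&` B)).
Proof.
move=> cB BK uF vF.
rewrite -(charge_integral_indic closedK); last 2 first.
- exact: closedI.
- by move=> p [_ /BK].
have bB := indic_bounded_borel cB.
have lim1 := inner_act_cvg uF (y := act \1_B (d X v)).
apply: (cvg_unique _ lim1) => //.
rewrite indicI.
have -> : (fun n => inner (symbol X (g n) u) (act \1_B (d X v))) =
    (fun n => charge_integral K (nu X v u) (fun p => g n p * \1_B p)).
  apply/funext => n; rewrite inner_sym act_symbol //; last exact: in_C_cst.
  by apply: eq_charge_integral => p _; rewrite mulr1 mulrC.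
apply: (@bump_integral_cvg _ _ 1); first exact: indic_measurable.
by move=> p _; rewrite indicE; case: (p \in B); rewrite ?normr1 ?normr0.
Qed.

Lemma inner_act_d u v : in_F K u -> in_F K v ->
  inner (act \1_A (d X u)) (d X v) = fine (nu X u v A).
Proof.
move=> uF vF; have bA := indic_bounded_borel cA.
rewrite act_symbol //; try exact: in_C_cst.
rewrite -(charge_integral_indic closedK) //.
by apply: eq_charge_integral => p _; rewrite !mulr1.
Qed.

End Bump.

End Action.

(** * Cells, junction points and pieces of forms *)

Section Cells.
Variable R : realType.
Local Notation plane := (R^o * R^o)%type.
Local Notation q := (@q R).
Local Notation r := (r R).
Local Notation borel := (borel R).
Variables (K : set plane) (X : one_forms K).
Hypothesis attrK : is_attractor K.

Lemma cell_closed (w : word) : closed (cell K w).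
Proof.
apply: (compact_closed (@plane_hausdorff R)); apply: continuous_compact.
  by apply: continuous_subspaceT; exact: Fw_continuous.
exact: attractor_compact.
Qed.

Lemma cell_nonempty (w : word) : cell K w !=set0.
Proof. by exists (Fw w (q 0)); exists (q 0) => //; exact: attractor_q. Qed.

Lemma cell_sub (w : word) : cell K w `<=` K.
Proof. by move=> _ [p Kp <-]; exact: attractor_Fw. Qed.

Lemma cell_cat_sub (v w : word) : cell K (v ++ w) `<=` cell K v.
Proof.
by move=> _ [p Kp <-]; exists (Fw w p); [exact: attractor_Fw|rewrite Fw_cat].
Qed.

Lemma cell_split (c : word) : cell K c =
  cell K (rcons c 0) `|` cell K (rcons c 1) `|` cell K (rcons c 2%:R).
Proof.
apply/seteqP; split=> p.
  move=> [p' /(attractor_split attrK)[j [p'' [Kp'' ->]]] <-].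
  by move: j; apply: ord3_ind; [left; left|left; right|right];
    exists p''; rewrite ?Fw_rcons.
by case=> [[]|]; rewrite -cats1; exact: cell_cat_sub.
Qed.

Lemma cell_junction (c : word) j k : j != k ->
  cell K (rcons c j) `&` cell K (rcons c k) = [set Fw (rcons c j) (q k)].
Proof.
move=> jk; apply/seteqP; split=> p.
  rewrite -!cats1 => -[[p1 K1 <-] [p2 K2 e]].
  have [-> _ _] := attractor_branch attrK jk K1 K2 (esym e).
  by rewrite cats1.
move=> ->; split; first by exists (q k) => //; exact: attractor_q.
exists (q j); first exact: attractor_q.
by rewrite !Fw_rcons F_sym.
Qed.

Lemma cell_branch c j k (x y : word) : j != k ->
  cell K (c ++ j :: x) `&` cell K (c ++ k :: y) `<=` [set Fw (rcons c j) (q k)].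
Proof.
by move=> jk p [[p1 K1 <-] [p2 K2 /esym /(attractor_branch attrK jk K1 K2)[]]].
Qed.

Section Measure.
Variable mu : {charge set borel -> \bar R}.

Lemma fine_chargeU (A B : set plane) : closed A -> closed B ->
  fine (mu (A `|` B)) + fine (mu (A `&` B)) = fine (mu A) + fine (mu B).
Proof.
move=> /measurable_closed mA /measurable_closed mB.
have mBA : measurable (B `\` A : set borel) by exact: measurableD.
have -> : A `|` B = A `|` (B `\` A) by rewrite setUDr setDv setD0.
rewrite chargeU ?setDIK //.
rewrite fineD ?fin_num_measure // chargeD // fineB ?fin_num_measure //.
  by rewrite [B `&` A]setIC; ring.
exact: measurableI.
Qed.

End Measure.

Local Notation spike p u := (act (\1_[set p] : plane -> R) (d X u)).

Lemma set1_closed (p : plane) : closed [set p].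
Proof. exact: (accessible_closed_set1 (hausdorff_accessible (@plane_hausdorff R))). Qed.

Lemma inner_spike p u v : K p -> in_F K u -> in_F K v ->
  inner (spike p u) (spike p v) = fine (nu X v u [set p]).
Proof.
move=> Kp uF vF; have pK : [set p] `<=` K by move=> _ ->.
by rewrite inner_act ?setIid //; [exact: set1_closed|exists p|exact: set1_closed].
Qed.

(* Energy measures do not charge junction points: their values at the three
   junctions of a cell are nonnegative and, by inclusion-exclusion and the
   additivity of the energy, sum to zero. *)
Lemma spike_junction c j k u : j != k -> in_F K u ->
  spike (Fw (rcons c j) (q k)) u = 0.
Proof.
move=> jk uF; pose mu := nu X u u; pose m (A : set plane) := fine (mu A).
pose P a b := Fw (rcons c a) (q b).
have Psym a b : P a b = P b a by rewrite /P !Fw_rcons F_sym.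
have KP a b : K (P a b) by apply: attractor_Fw => //; exact: attractor_q.
have m_ge0 a b : 0 <= m [set P a b].
  by rewrite /m /mu -inner_spike //; exact: inner_ge0.
have cl := cell_closed.
have mcell w : m (cell K w) = r ^- size w * energy K (u \o Fw w) (u \o Fw w).
  by rewrite /m /mu energy_measureE.
have split3 : m (cell K c) = \sum_a m (cell K (rcons c a)).
  rewrite mcell (energy_split attrK); try exact: in_F_Fw.
  rewrite mulrA mulr_sumr; apply: eq_bigr => a _.
  rewrite mcell size_rcons exprSr (invfM (r ^+ size c) r); congr (_ * _).
  by apply: (energy_eq attrK) => w i; rewrite /= Fw_rcons.
have sum0 : m [set P 0 1] + (m [set P 0 2%:R] + m [set P 1 2%:R]) = 0.
  have U1 := fine_chargeU mu (closedU (cl (rcons c 0)) (cl (rcons c 1)))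
    (cl (rcons c 2%:R)).
  have U2 := fine_chargeU mu (cl (rcons c 0)) (cl (rcons c 1)).
  have U3 := fine_chargeU mu (@set1_closed (P 0 2%:R)) (@set1_closed (P 1 2%:R)).
  move: U1 U2 U3; rewrite -cell_split setIUl !cell_junction // -!/(P _ _).
  (* Cell 2 meets the union of the other two in two distinct junctions, so their masses add. *)
  rewrite (_ : [set P 0 2%:R] `&` [set P 1 2%:R] = set0); last first.
    apply/seteqP; split=> // p [-> /=] /eqP.
    rewrite (Psym 0) (Psym 1) => /eqP /Fw_inj /q_inj /eqP.
    by [].
  rewrite charge0 -!/(m _) split3 sum_ord3 /= -!/(m _); lra.
have zero a b : a != b -> m [set P a b] = 0.
  have := m_ge0 0 1; have := m_ge0 0 2%:R; have := m_ge0 1 2%:R => h1 h2 h3.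
  move: a b; apply: ord3_ind; apply: ord3_ind => // _;
    rewrite ?(Psym 1 0) ?(Psym 2%:R); lra.
apply: inner_eq0; rewrite (inner_spike (KP j k) uF uF); exact: zero.
Qed.

Local Notation restr w u := (act (\1_(cell K w) : plane -> R) (d X u)).

(** Such cells share at most one junction point. The signed mass there is an inner product of two
    spikes, so it vanishes with the spikes. *)
Lemma inner_restr_branch c j k (x y : word) u v : j != k ->
  in_F K u -> in_F K v ->
  inner (restr (c ++ j :: x) u) (restr (c ++ k :: y) v) = 0.
Proof.
move=> jk uF vF.
rewrite inner_act //; try exact: cell_closed; try exact: cell_sub; last first.
  exact: cell_nonempty.
have := @cell_branch c j k x y jk; set A := _ `&` _; set p := Fw _ _ => Ap.
have Kp : K p by apply: attractor_Fw => //; exact: attractor_q.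
have [/eqP ->|/set0P[z Az]] := boolP (A == set0); first by rewrite charge0.
have -> : A = [set p].
  by apply/seteqP; split=> // _ ->; rewrite -(Ap _ Az).
by rewrite -inner_spike // spike_junction // inner0l.
Qed.

Lemma inner_restr_nested (x y : word) u v : in_F K u -> in_F K v ->
  inner (restr x u) (restr (x ++ y) v) =
  r ^- size (x ++ y) *
  energy K (u \o Fw (x ++ y)) (v \o Fw (x ++ y)).
Proof.
move=> uF vF.
rewrite inner_act //; try exact: cell_closed; try exact: cell_sub; last first.
  exact: cell_nonempty.
rewrite setIidr; last exact: cell_cat_sub.
by rewrite energy_measureE //= (energy_sym attrK).
Qed.

Lemma inner_restr_d (x : word) u v : in_F K u -> in_F K v ->
  inner (restr x u) (d X v) =
  r ^- size x * energy K (u \o Fw x) (v \o Fw x).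
Proof.
move=> uF vF.
rewrite inner_act_d //; try exact: cell_closed; try exact: cell_sub.
by rewrite energy_measureE.
Qed.

Definition piece (w : word) (U : plane -> R) : X := restr w (extension K w U).

(** [extension] is an arbitrary choice away from the cell; only its agreement with [U] inside makes
    inner products of pieces computable. *)
Lemma extension_eq_vertices (w x : word) (U : plane -> R) : in_F K (U \o Fw w) ->
  eq_vertices (extension K w U \o Fw (w ++ x)) (U \o Fw (w ++ x)).
Proof.
move=> UF; have [_ e] := extensionP attrK UF.
apply: (eq_vertices_K attrK) => p Kp /=; apply: e.
by apply: (@cell_cat_sub w x); exists p.
Qed.

Lemma inner_piece (w : word) (U U' : plane -> R) :
  in_F K (U \o Fw w) -> in_F K (U' \o Fw w) ->
  inner (piece w U) (piece w U') =
  r ^- size w * energy K (U \o Fw w) (U' \o Fw w).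
Proof.
move=> UF UF'; have [eF _] := extensionP attrK UF.
have [eF' _] := extensionP attrK UF'.
have := @inner_restr_nested w [::] _ _ eF eF'; rewrite cats0 => ->.
congr (_ * _); have := @extension_eq_vertices w [::] _ UF.
have := @extension_eq_vertices w [::] _ UF'; rewrite cats0 => e' e.
exact: (energy_eq attrK).
Qed.

(** The chosen extension of 0 need not vanish off the cell, hence the argument by the norm. *)
Lemma piece0 (w : word) : piece w (cst 0) = 0.
Proof.
have cF : in_F K (cst 0 \o @Fw R w) by exact: (in_F_cst attrK 0).
apply: inner_eq0; rewrite inner_piece //.
by rewrite (energy_cst attrK 0 (cst 0 \o Fw w)) mulr0.
Qed.

Lemma d_cst a : d X (cst a) = 0.
Proof.
have aF := in_F_cst attrK a.
by apply: inner_eq0; rewrite inner_d // (energy_cst attrK a (cst a)).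
Qed.

End Cells.

(** * Loops *)

Lemma ord3_addE : ((0 + 1 = 1 :> 'I_3)%R * (1 + 1 = 2%:R :> 'I_3)%R *
  (2%:R + 1 = 0 :> 'I_3)%R * (0 + 2%:R = 2%:R :> 'I_3)%R *
  (1 + 2%:R = 0 :> 'I_3)%R * (2%:R + 2%:R = 1 :> 'I_3)%R)%type.
Proof. by do !split; apply: val_inj. Qed.

Lemma sum_tuple_rcons (W : nmodType) (w : word) (G : word -> W) :
  (forall x, size x = (size w).+1 -> x != rcons w (last ord0 x) -> G x = 0) ->
  \sum_(x : (size w).+1.-tuple 'I_3) G x = \sum_j G (rcons w j).
Proof.
move=> G0.
transitivity (\sum_(x : (size w).+1.-tuple 'I_3)
    \sum_j if (x : word) == rcons w j then G x else 0).
  apply: eq_bigr => x _; rewrite -big_mkcond /=.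
  have [xE|nx] := eqVneq (x : word) (rcons w (last ord0 x)).
    rewrite (big_pred1 (last ord0 x)) // => j /=; rewrite {1}xE.
    by rewrite eqseq_rcons eqxx eq_sym.
  rewrite G0 ?size_tuple // big_pred0 // => j; apply: contra_neqF nx => /eqP xE.
  by rewrite xE last_rcons.
rewrite exchange_big /=; apply: eq_bigr => j _; rewrite -big_mkcond /=.
have sj : size (rcons w j) == (size w).+1 by rewrite size_rcons.
by rewrite (big_pred1 (Tuple sj)).
Qed.

Section Loops.
Variable R : realType.
Local Notation plane := (R^o * R^o)%type.
Local Notation q := (@q R).
Local Notation r := (r R).
Variables (K : set plane) (X : one_forms K) (psi : 'I_3 -> plane -> R).
Hypothesis attrK : is_attractor K.
Hypothesis loopP : is_loop_function K psi.

Lemma loop_harmonic j : Defs.harmonic K (psi j \o F j).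
Proof. by case: (loopP j). Qed.

Lemma loop_in_F j : in_F K (psi j \o F j).
Proof. by case: (loop_harmonic j). Qed.

Lemma loop_corner j : corners (psi j \o F j) j = 0.
Proof. by case: (loopP j) => _ p0 _ _; rewrite /corners /= F_fixed. Qed.

Lemma loop_corner1 j : corners (psi j \o F j) (j + 1) = 1.
Proof. by case: (loopP j). Qed.

Lemma loop_corner2 j : corners (psi j \o F j) (j + 2%:R) = -1.
Proof. by case: (loopP j). Qed.

(** The corner values 0, 1, -1 have flux 2 - 0 - (-1) = 3 at [j + 1], the opposite at [j + 2], and
    none at [j]. *)
Lemma loop_energy j v :
  energy K (psi j \o F j) v = 3 * (v (q (j + 1)) - v (q (j + 2%:R))).
Proof.
rewrite (harmonic_energy attrK v (loop_harmonic j)) triangle_energyE.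
have := loop_corner j; have := loop_corner1 j; have := loop_corner2 j.
by move: j; apply: ord3_ind; rewrite !ord3_addE => -> -> ->;
  rewrite /corners; ring.
Qed.

(* The contributions of the three cells at each junction cancel. *)
Lemma loop_flux u : \sum_j energy K (psi j \o F j) (u \o F j) = 0.
Proof.
rewrite sum_ord3 !loop_energy /= !ord3_addE (F_sym R 1 0) (F_sym R 2%:R 0).
by rewrite (F_sym R 2%:R 1); ring.
Qed.

Definition loop_piece (w : word) j : plane -> R := psi j \o Fw_inv w.

Lemma loop_piece_Fw (w : word) j :
  loop_piece w j \o Fw (rcons w j) = psi j \o F j.
Proof. by apply/funext => p; rewrite /loop_piece /= Fw_rcons Fw_K. Qed.

Lemma loop_piece_in_F (w : word) j : in_F K (loop_piece w j \o Fw (rcons w j)).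
Proof. by rewrite loop_piece_Fw; exact: loop_in_F. Qed.

Lemma loop_rcons (w : word) j : loop psi w (rcons w j) = loop_piece w j.
Proof. by rewrite /loop last_rcons eqxx. Qed.

Lemma loop_other (w x : word) : x != rcons w (last ord0 x) ->
  loop psi w x = cst 0.
Proof. by rewrite /loop => /negbTE ->. Qed.

Lemma d_piecewise_eq n (U U' : Defs.family R) :
  (forall x, size x = n -> U x = U' x) -> d_piecewise X n U = d_piecewise X n U'.
Proof.
case: n => [|n] UU' /=; first by rewrite UU'.
by apply: eq_bigr => x _; rewrite UU' ?size_tuple.
Qed.

Lemma d_piecewise0 n (U : Defs.family R) :
  (forall x, size x = n.+1 -> U x = cst 0) -> d_piecewise X n.+1 U = 0.
Proof.
move=> U0 /=; rewrite big1 // => x _; rewrite U0 ?size_tuple //.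
exact: (piece0 X attrK).
Qed.

Lemma d_loopE (w : word) :
  d_loop X psi w = \sum_j piece X (rcons w j) (loop_piece w j).
Proof.
rewrite /d_loop /= (sum_tuple_rcons (G := fun x => piece X x (loop psi w x))).
  by apply: eq_bigr => j _; rewrite loop_rcons.
by move=> x _ /loop_other ->; exact: piece0.
Qed.

(** A loop supported inside the cell of [z] sees du there without the cutoff, so its balanced flux
    applies. *)
Lemma inner_restr_loop (z t : word) u : in_F K u ->
  inner (act (\1_(cell K z) : plane -> R) (d X u)) (d_loop X psi (z ++ t)) = 0.
Proof.
move=> uF; rewrite d_loopE inner_sumr.
rewrite (eq_bigr (fun j => r ^- (size (z ++ t)).+1 *
    energy K (psi j \o F j) ((u \o Fw (z ++ t)) \o F j))).
  by rewrite -mulr_sumr loop_flux mulr0.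
move=> j _; rewrite /piece.
have [eF _] := extensionP attrK (loop_piece_in_F (z ++ t) j).
have := @inner_restr_nested _ _ X attrK z (rcons t j) _ _ uF eF.
rewrite -rcons_cat => ->; rewrite size_rcons; congr (_ * _).
rewrite (energy_sym attrK); apply: (energy_eq attrK).
  have := @extension_eq_vertices _ _ attrK (rcons (z ++ t) j) [::] _
    (loop_piece_in_F (z ++ t) j).
  by rewrite cats0 loop_piece_Fw.
by move=> w i; rewrite /= Fw_rcons.
Qed.

Lemma inner_restr_loop_branch c j k (x y : word) u : j != k -> in_F K u ->
  inner (act (\1_(cell K (c ++ j :: x)) : plane -> R) (d X u))
    (d_loop X psi (c ++ k :: y)) = 0.
Proof.
move=> jk uF; rewrite d_loopE inner_sumr big1 // => l _.
have [eF _] := extensionP attrK (loop_piece_in_F (c ++ k :: y) l).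
have := @inner_restr_branch _ _ X attrK c j k x (rcons y l) _ _ jk uF eF.
by rewrite -rcons_cons -rcons_cat.
Qed.

(** The longer loop lives in a single child cell of [w], where the shorter one coincides with an
    exact form. *)
Lemma d_loop_orthogonal_cat (w t : word) j :
  inner (d_loop X psi w) (d_loop X psi (w ++ j :: t)) = 0.
Proof.
rewrite (d_loopE w) inner_suml big1 // => k _.
have [eF _] := extensionP attrK (loop_piece_in_F w k).
have [->|kj] := eqVneq k j.
  have [eF' _] := extensionP attrK (loop_piece_in_F w j).
  by rewrite -cat_rcons inner_restr_loop.
have := inner_restr_loop_branch w [::] t kj eF.
by rewrite cats1.
Qed.

Lemma d_loop_orthogonal (v w : word) : v != w ->
  inner (d_loop X psi v) (d_loop X psi w) = 0.
Proof.
have cat_neq (x y : word) : x != x ++ y -> exists j t, y = j :: t.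
  by case: y => [|j t]; [rewrite cats0 eqxx|exists j, t].
case: (word_compare v w) => [[x ->]|[x ->]|[c [j [k [x [y [-> -> jk]]]]]]].
- by move=> /cat_neq [j [t ->]]; exact: d_loop_orthogonal_cat.
- rewrite eq_sym => /cat_neq [j [t ->]].
  by rewrite inner_sym; exact: d_loop_orthogonal_cat.
move=> _; rewrite (d_loopE (c ++ j :: x)) inner_suml big1 // => l _.
have [eF _] := extensionP attrK (loop_piece_in_F (c ++ j :: x) l).
have := inner_restr_loop_branch c (rcons x l) y jk eF.
by rewrite -rcons_cons -rcons_cat.
Qed.

(** Three cells contribute 6 each, which is 3 * (1 - (-1)) by [loop_energy]; pieces on different
    cells are orthogonal. *)
Lemma d_loop_norm (w : word) :
  inner (d_loop X psi w) (d_loop X psi w) = 18 * r ^- (size w).+1.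
Proof.
have e j k : inner (piece X (rcons w j) (loop_piece w j))
    (piece X (rcons w k) (loop_piece w k)) =
    if j == k then 6 * r ^- (size w).+1 else 0.
  have [<-|jk] := eqVneq j k.
    rewrite inner_piece //; try exact: loop_piece_in_F.
    rewrite !loop_piece_Fw size_rcons loop_energy.
    have /= := loop_corner1 j; have /= := loop_corner2 j.
    by rewrite /corners /= => -> ->; ring.
  have [eF _] := extensionP attrK (loop_piece_in_F w j).
  have [eF' _] := extensionP attrK (loop_piece_in_F w k).
  have := @inner_restr_branch _ _ X attrK w j k [::] [::] _ _ jk eF eF'.
  by rewrite !cats1; apply.
rewrite {1}d_loopE inner_suml (eq_bigr (fun _ => 6 * r ^- (size w).+1)).
  by rewrite sum_ord3; ring.
move=> j _; rewrite d_loopE inner_sumr (bigD1 j) //= e eqxx big1 ?addr0 //.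
by move=> k kj; rewrite e eq_sym (negbTE kj).
Qed.

Lemma d_loop_ker (w : word) : in_ker_dstar (d_loop X psi w).
Proof.
move=> u uF; rewrite d_loopE inner_suml.
rewrite (eq_bigr (fun j => r ^- (size w).+1 *
    energy K (psi j \o F j) ((u \o Fw w) \o F j))).
  by rewrite -mulr_sumr loop_flux mulr0.
move=> j _; have wF := loop_piece_in_F w j.
have [eF _] := extensionP attrK wF.
rewrite /piece inner_restr_d // size_rcons.
congr (_ * _); apply: (energy_eq attrK).
  by have := @extension_eq_vertices _ _ attrK (rcons w j) [::] _ wF;
    rewrite cats0 loop_piece_Fw.
by move=> v i; rewrite /= Fw_rcons.
Qed.

Definition composed_loop (w v : word) : X :=
  d_piecewise X ((size v).+1 - size w)
    (compose_family (size v).+1 (loop psi v) w).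

Lemma composed_loop_cat (w v : word) :
  composed_loop w (w ++ v) = d_loop X psi v.
Proof.
rewrite /composed_loop size_cat -addnS addKn /d_loop.
apply: d_piecewise_eq => x sx.
rewrite /compose_family take_oversize; last by rewrite size_cat sx.
have [j xE] : exists j, x = rcons (take (size v) x) j.
  exists (last ord0 x); case/lastP: x sx => // x j; rewrite size_rcons => -[<-].
  by rewrite last_rcons -{2}cats1 take_size_cat.
have last_x : last ord0 (w ++ x) = last ord0 x by rewrite xE -rcons_cat !last_rcons.
have [xv|nxv] := eqVneq x (rcons v (last ord0 x)).
  rewrite {1}xv -rcons_cat loop_rcons {2}xv loop_rcons.
  by apply/funext => p; rewrite /loop_piece /= Fw_inv_cat Fw_K.
rewrite !loop_other //; apply: contra nxv.
by rewrite last_x rcons_cat eqseq_cat // eqxx.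
Qed.

Lemma composed_loop_take (w : word) k : (k < size w)%N ->
  composed_loop w (take k w) =
  d X (compose_family k.+1 (loop psi (take k w)) w [::]).
Proof.
move=> kw; rewrite /composed_loop size_take kw.
(* The truncated level is 0, and there [d_piecewise] reads only the component at [[::]]. *)
by have /eqP -> : (k.+1 - size w == 0)%N by rewrite subn_eq0.
Qed.

Lemma composed_loop_other (w v : word) : (size w <= size v)%N ->
  take (size w) v != w -> composed_loop w v = 0.
Proof.
move=> wv nw; rewrite /composed_loop subSn //; apply: d_piecewise0 => x sx.
rewrite /compose_family take_oversize; last by rewrite size_cat sx addnS subnKC.
rewrite loop_other //; apply: contra_neq nw => e.
have := congr1 (take (size w)) e.
by rewrite take_size_cat // -cats1 takel_cat.
Qed.

End Loops.

(** * Unordered sums *)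

#[local] Existing Instance totally_filter.

Section UnorderedSums.
Variables (R : realType) (V : normedModType R).

Lemma partial_sumE (I : choiceType) (f : I -> V) (B : {fset I}) :
  partial_sum f B = \sum_(x <- B) f x.
Proof. by rewrite /partial_sum big_seq_fsetE. Qed.

(** Duplicate-free lists in place of finite sets let index sets be concatenated, filtered and mapped
    directly. *)
Lemma totally_cvgP (I : choiceType) (f : I -> V) (l : V) :
  partial_sum f @ totally --> l <->
  forall e, 0 < e -> exists A : seq I, forall s, uniq s -> {subset A <= s} ->
    `|l - \sum_(x <- s) f x| < e.
Proof.
split=> [/cvgrPdist_lt fl e e0|fl].
  have [A _ fA] := fl e e0; exists A => s us As.
  have : `|l - partial_sum f [fset x in s]%fset| < e.
    by apply: fA => /=; apply/fsubsetP => x /As; rewrite inE.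
  have ps : perm_eq [fset x in s]%fset s by apply: uniq_perm => // x; rewrite inE.
  by rewrite partial_sumE (perm_big _ ps).
apply/cvgrPdist_lt => e e0; have [A fA] := fl e e0.
exists [fset x in A]%fset => // B /= /fsubsetP AB.
by rewrite partial_sumE; apply: fA => // x xA; apply: AB; rewrite inE.
Qed.

(** Reindexes a family supported on a finite list [P] and the range of an injection [h]. It serves
    twice: with [h] prefixing by [w], and with [h] sending [m] to the word w i^m. *)
Lemma totally_cvg_image (I J : choiceType) (f : I -> V) (h : J -> I)
    (h' : I -> option J) (P : seq I) (l : V) :
  pcancel h h' -> ocancel h' h -> uniq P -> (forall j, h j \notin P) ->
  (forall x, x \notin P -> h' x = None -> f x = 0) ->
  partial_sum (f \o h) @ totally --> l ->
  partial_sum f @ totally --> \sum_(x <- P) f x + l.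
Proof.
move=> hK h'K uP hP f0 /totally_cvgP fl; apply/totally_cvgP => e /fl[A fA].
exists (P ++ map h A) => s us As.
have sumP : \sum_(x <- s | x \in P) f x = \sum_(x <- P) f x.
  rewrite -big_filter; apply: perm_big; apply: uniq_perm => //.
    exact: filter_uniq.
  move=> x; rewrite mem_filter; case: (boolP (x \in P)) => //= xP.
  by apply: As; rewrite mem_cat xP.
have sumh : \sum_(x <- s | x \notin P) f x = \sum_(j <- pmap h' s) (f \o h) j.
  elim: s {us As sumP} => [|x s IH]; first by rewrite !big_nil.
  rewrite big_cons IH /=; case h'x: (h' x) => [j|] /=.
    have xE : h j = x by have := h'K x; rewrite h'x.
    by rewrite -xE hP big_cons.
  by case: ifP => // xP; rewrite (f0 x xP h'x) add0r.
rewrite [\sum_(x <- s) _](bigID (fun x => x \in P)) /= sumP sumh opprD addrACA subrr add0r.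
apply: fA; first exact: (pmap_uniq h'K).
move=> j jA; by rewrite mem_pmap -hK map_f // As // mem_cat map_f ?orbT.
Qed.

End UnorderedSums.

Section UnorderedSeries.
Variable R : realType.
Implicit Type a : nat -> R.

Lemma series_le_lim a n : (forall m, 0 <= a m) -> cvgn (series a) ->
  series a n <= limn (series a).
Proof.
move=> a0 ca; apply: nondecreasing_cvgn_le => //.
by apply/nondecreasing_seqP => m; rewrite seriesSr lerDl.
Qed.

Lemma sum_uniq_le (I : eqType) (s t : seq I) (b : I -> R) : uniq s ->
  {subset s <= t} -> (forall i, 0 <= b i) ->
  \sum_(i <- s) b i <= \sum_(i <- t) b i.
Proof.
move=> us st b0; have -> : \sum_(i <- s) b i = \sum_(i <- undup t | i \in s) b i.
  rewrite -[RHS]big_filter; apply: perm_big; apply: uniq_perm => //.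
    by rewrite filter_uniq ?undup_uniq.
  move=> i; rewrite mem_filter mem_undup.
  by case: (boolP (i \in s)) => // /st ->.
apply: (@le_trans _ _ (\sum_(i <- undup t) b i)).
  by rewrite [leRHS](bigID (fun i => i \in s)) /= lerDl sumr_ge0.
elim: t {st} => //= i t IH; rewrite big_cons; case: ifP => _.
  by rewrite (le_trans IH) // lerDr.
by rewrite big_cons lerD2l.
Qed.

Lemma series_totally_cvg a : cvgn (series (fun m => `|a m|)) ->
  partial_sum (a : nat -> R^o) @ totally --> (limn (series a) : R^o).
Proof.
move=> ca; have ca' : cvgn (series a) by exact: normed_cvg.
apply/totally_cvgP => e e0.
have e2 : 0 < e / 2 by rewrite divr_gt0.
have /cvgrPdist_lt /(_ _ e2)[N1 _ HN1] := ca'.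
have /cvgrPdist_lt /(_ _ e2)[N2 _ HN2] := ca.
(* At [N] the partial sum and the tail of absolute values are both within [e / 2]; the indices of
   [s] from [N] on are charged to that tail. *)
pose N := maxn N1 N2; exists (iota 0 N) => s us Ns.
have lN : `|limn (series a) - series a N| < e / 2 by apply: HN1; exact: leq_maxl.
have lN' : `|limn (series (fun m => `|a m|)) - series (fun m => `|a m|) N| < e / 2.
  by apply: HN2; exact: leq_maxr.
rewrite (bigID (fun m => m < N)%N) /=.
have -> : \sum_(m <- s | (m < N)%N) (a m : R^o) = series a N.
  rewrite /series /= -big_filter -[RHS]/(\sum_(m <- iota 0 (N - 0)) a m) subn0.
  apply: perm_big; apply: uniq_perm; rewrite ?filter_uniq ?iota_uniq // => m.
  rewrite mem_filter mem_iota /= add0n.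
  by case: (boolP (m < N)%N) => // mN; apply: Ns; rewrite mem_iota.
rewrite opprD addrA; apply: le_lt_trans (ler_normB _ _) _.
have -> : e = e / 2 + e / 2 by field.
apply: ltrD => //; apply: le_lt_trans lN'.
apply: le_trans (ler_norm_sum _ _ _) _.
apply: le_trans (ler_norm _); rewrite lerBrDl.
pose M := (\max_(m <- s) m).+1.
have -> : series (fun m => `|a m|) N + \sum_(m <- s | ~~ (m < N)%N) `|a m| =
    \sum_(m <- iota 0 N ++ [seq m <- s | ~~ (m < N)%N]) `|a m|.
  by rewrite big_cat big_filter /series /= /index_iota subn0.
apply: le_trans (series_le_lim (maxn M N) _ ca) => //.
rewrite /series /= /index_iota subn0; apply: sum_uniq_le => //.
  rewrite cat_uniq iota_uniq filter_uniq // andbT /=; apply/hasPn => m.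
  by rewrite mem_filter mem_iota /= add0n => /andP[].
move=> m; rewrite mem_cat !mem_iota /= !add0n leq_max => /orP[->|]; first exact: orbT.
rewrite mem_filter => /andP[_ ms]; apply/orP; left; rewrite ltnS.
exact: (@leq_bigmax_seq _ s xpredT id m).
Qed.

Lemma totally_cvg_summable (I : choiceType) (f : I -> R) (l : R) :
  partial_sum ((fun i => `|f i|) : I -> R^o) @ totally --> (l : R^o) ->
  esum.summable [set: I] (fun i => (f i)%:E).
Proof.
move=> /totally_cvgP /(_ 1 ltr01)[A fA].
rewrite /esum.summable; apply: (@le_lt_trans _ _ (l + 1)%:E); last exact: ltry.
rewrite /esum; apply: ge_ereal_sup => _ [B [finB _] <-].
rewrite fsbig_finite //=; set s := enum_fset _.
have us : uniq s by exact: fset_uniq.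
have : `|l - (\sum_(x <- undup (s ++ A)) `|f x| )| < 1.
  apply: fA; first exact: undup_uniq.
  by move=> x xA; rewrite mem_undup mem_cat xA orbT.
rewrite distrC => /(le_lt_trans (ler_norm _)); rewrite ltrBlDl => /ltW le1.
rewrite sumEFin lee_fin; apply: le_trans le1.
by apply: sum_uniq_le => // x xs; rewrite mem_undup mem_cat xs.
Qed.

End UnorderedSeries.

(** * Expansions in the loop basis *)

Section LoopSeries.
Variable R : realType.
Local Notation plane := (R^o * R^o)%type.
Local Notation r := (r R).
Variables (K : set plane) (X : one_forms K) (psi : 'I_3 -> plane -> R).
Hypothesis attrK : is_attractor K.
Hypothesis loopP : is_loop_function K psi.
Implicit Types (c : word -> R) (Theta : X).

Local Notation loop_sum c := (partial_sum (fun w => c w *: d_loop X psi w)).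

(** By orthogonality the inner product of a partial sum with the loop at [w] is constant as soon as
    the index set contains [w]. *)
Lemma loop_coefficient c Theta (w : word) : loop_sum c @ totally --> Theta ->
  inner Theta (d_loop X psi w) = c w * (18 * r ^- (size w).+1).
Proof.
move=> cT.
have lim1 : inner (loop_sum c B) (d_loop X psi w) @[B --> totally] -->
    inner Theta (d_loop X psi w) by exact: inner_cvg.
apply: (cvg_unique _ lim1) => //; apply: cvg_near_cst.
exists [fset w]%fset => // B /= /fsubsetP wB.
have {wB} : w \in B by apply: wB; rewrite inE.
rewrite partial_sumE inner_suml => wB.
rewrite (bigD1_seq w) ?fset_uniq //= innerZl d_loop_norm // big1 ?addr0 // => v vw.
by rewrite innerZl d_loop_orthogonal // mulr0.
Qed.

Lemma loop_coefficient_unique c c' Theta : loop_sum c @ totally --> Theta ->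
  loop_sum c' @ totally --> Theta -> c = c'.
Proof.
move=> cT cT'; apply/funext => w.
have := loop_coefficient w cT; rewrite (loop_coefficient w cT').
have n0 : 18 * r ^- (size w).+1 != 0.
  by rewrite mulf_neq0 ?invr_eq0 ?expf_neq0 ?r_neq0.
by move/(mulIf n0).
Qed.

Lemma loop_sum_ker c Theta : loop_sum c @ totally --> Theta ->
  in_ker_dstar Theta.
Proof.
move=> cT u uF.
have lim1 : inner (loop_sum c B) (d X u) @[B --> totally] -->
    inner Theta (d X u) by exact: inner_cvg.
apply: (cvg_unique _ lim1) => //; apply: cvg_near_cst.
apply: filterE => B; rewrite partial_sumE inner_suml big1 // => w _.
by rewrite innerZl d_loop_ker // mulr0.
Qed.

Lemma loop_sum_norm (a : word -> R) (s : seq word) : uniq s ->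
  `|\sum_(v <- s) a v *: d_loop X psi v| ^+ 2 =
  \sum_(v <- s) a v ^+ 2 * (18 * r ^- (size v).+1).
Proof.
move=> us; rewrite -inner_norm inner_suml big_seq [RHS]big_seq.
apply: eq_bigr => v vs; rewrite inner_sumr (bigD1_seq v) //= big1 ?addr0.
  by rewrite innerZl innerZr d_loop_norm //; ring.
by move=> x xv; rewrite innerZl innerZr d_loop_orthogonal 1?eq_sym // !mulr0.
Qed.

(* Prefixing with w multiplies squared norms of the loops by r^-|w| >= 1. *)
Lemma loop_sum_shift_le (a : word -> R) (w : word) (s : seq word) : uniq s ->
  `|\sum_(v <- s) a (w ++ v) *: d_loop X psi v| <=
  `|\sum_(x <- map (cat w) s) a x *: d_loop X psi x|.
Proof.
move=> us; rewrite -(@ler_pXn2r _ 2) ?nnegrE //.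
have inj : injective (cat w) by move=> x y /eqP; rewrite eqseq_cat // eqxx => /eqP.
rewrite loop_sum_norm // loop_sum_norm ?map_inj_uniq // big_map.
apply: ler_sum => v _; rewrite ler_wpM2l ?sqr_ge0 // ler_wpM2l //.
have r0 := r_gt0 R; have r1 : r <= 1 by rewrite /Defs.r; lra.
rewrite lef_pV2 ?posrE ?exprn_gt0 // size_cat -addnS exprD.
by rewrite ler_piMl ?exprn_ge0 ?exprn_ile1 // ltW.
Qed.

(** By [loop_sum_shift_le] the shifted sums are dominated by blocks of the given convergent sum, so
    they are Cauchy in a complete space. *)
Lemma loop_sum_shift_cvg c Theta (w : word) : loop_sum c @ totally --> Theta ->
  exists Theta', loop_sum (fun v => c (w ++ v)) @ totally --> Theta'.
Proof.
move=> cT; apply/cvg_ex; apply/cauchy_cvgP; apply: cauchy_exP => e e0.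
have e2 : 0 < e / 2 by rewrite divr_gt0.
have /totally_cvgP /(_ _ e2)[A0 cA0] := cT.
(* Cutting [size w] letters off each word of [A0] ensures that [w ++ v] is outside [A0] whenever [v]
   is outside [A]. *)
pose A := map (drop (size w)) A0.
exists (\sum_(v <- undup A) c (w ++ v) *: d_loop X psi v).
exists [fset v in A]%fset => // B /= /fsubsetP AB.
rewrite -ball_normE /ball_ /= partial_sumE.
have AB' x : x \in A -> x \in B by move=> xA; apply: AB; rewrite inE.
rewrite [\sum_(x <- B) _](bigID (fun x => x \in A)) /=.
have -> : \sum_(x <- B | x \in A) c (w ++ x) *: d_loop X psi x =
    \sum_(v <- undup A) c (w ++ v) *: d_loop X psi v.
  rewrite -big_filter; apply: perm_big; apply: uniq_perm.
  - by rewrite filter_uniq ?fset_uniq.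
  - exact: undup_uniq.
  - by move=> x; rewrite mem_filter mem_undup; case: (boolP (x \in A)) => // /AB'.
rewrite opprD addrA subrr add0r normrN -big_filter.
set s := [seq _ <- _ | _]; have us : uniq s by rewrite filter_uniq ?fset_uniq.
apply: le_lt_trans (loop_sum_shift_le c w us) _.
have inj : injective (cat w) by move=> x y /eqP; rewrite eqseq_cat // eqxx => /eqP.
have disj x : x \in map (cat w) s -> x \notin undup A0.
  move=> /mapP[v vs ->]; rewrite mem_undup.
  move: vs; rewrite mem_filter => /andP[nvA _]; apply: contra nvA => wv.
  by apply/mapP; exists (w ++ v) => //; rewrite drop_size_cat.
pose S0 := \sum_(x <- undup A0) c x *: d_loop X psi x.
pose S1 := \sum_(x <- map (cat w) s) c x *: d_loop X psi x.
rewrite -/S1.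
have h2 : `|Theta - S0| < e / 2.
  by apply: cA0; [exact: undup_uniq|move=> x xA; rewrite mem_undup].
have h1 : `|Theta - (S0 + S1)| < e / 2.
  rewrite /S0 /S1 -big_cat; apply: cA0 => [|x xA].
    rewrite cat_uniq undup_uniq map_inj_uniq // us andbT /=.
    by apply/hasPn => x /disj.
  by rewrite mem_cat mem_undup xA.
have -> : S1 = (Theta - S0) - (Theta - (S0 + S1)).
  by rewrite opprB addrC addrA subrK addrC addKr.
apply: le_lt_trans (ler_normB _ _) _.
have -> : e = e / 2 + e / 2 by field.
exact: ltrD.
Qed.

Definition proper_prefixes (w : word) : seq word :=
  [seq take k w | k <- iota 0 (size w)].

Lemma mem_proper_prefixes (w x : word) :
  (x \in proper_prefixes w) = (size x < size w)%N && (take (size x) w == x).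
Proof.
apply/mapP/andP => [[k]|[xw /eqP xE]].
  by rewrite mem_iota add0n => /andP[_ kw] ->; rewrite size_takel // ltnW.
by exists (size x) => //; rewrite mem_iota.
Qed.

Lemma proper_prefixes_uniq (w : word) : uniq (proper_prefixes w).
Proof.
rewrite map_inj_in_uniq ?iota_uniq // => k l.
rewrite !mem_iota !add0n => /andP[_ kw] /andP[_ lw] /(congr1 size).
by rewrite !size_takel // ltnW.
Qed.

Lemma sum_proper_prefixes (W : nmodType) (w : word) (f : word -> W) :
  \sum_(x <- proper_prefixes w) f x = \sum_(k < size w) f (take k w).
Proof.
by rewrite big_map -{1}[size w]subn0 -/(index_iota 0 (size w)) big_mkord.
Qed.

Lemma cat_notin_proper_prefixes (w v : word) : w ++ v \notin proper_prefixes w.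
Proof. by rewrite mem_proper_prefixes size_cat ltnNge leq_addr. Qed.

End LoopSeries.

(** * Tangential parts *)

Section Tangential.
Variable R : realType.
Local Notation plane := (R^o * R^o)%type.
Local Notation q := (@q R).
Variables (K : set plane) (X : one_forms K) (psi : 'I_3 -> plane -> R).
Hypothesis attrK : is_attractor K.
Hypothesis loopP : is_loop_function K psi.
Implicit Types (c : word -> R) (Theta om : X) (eta : plane -> R).

(** [w] passes through just one child cell of its prefix [take k w], so composition with [Fw w]
    leaves one harmonic function of the loop there. *)
Definition prefix_function (w : word) (k : nat) : plane -> R :=
  compose_family k.+1 (loop psi (take k w)) w [::].

Lemma take_rcons_nth (w : word) k : (k < size w)%N ->
  take k.+1 w = rcons (take k w) (nth ord0 w k).
Proof. by move=> kw; rewrite -(take_nth ord0). Qed.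

Lemma prefix_functionE (w : word) k : (k < size w)%N ->
  prefix_function w k =
  (psi (nth ord0 w k) \o F (nth ord0 w k)) \o Fw (drop k.+1 w).
Proof.
move=> kw; rewrite /prefix_function /compose_family cats0 take_rcons_nth //.
rewrite loop_rcons -(@loop_piece_Fw _ psi (take k w)) -take_rcons_nth //.
by apply/funext => p /=; rewrite -Fw_cat cat_take_drop.
Qed.

Lemma prefix_function_in_F (w : word) k : (k < size w)%N ->
  in_F K (prefix_function w k).
Proof.
by move=> kw; rewrite prefix_functionE //; apply: in_F_Fw => //; exact: loop_in_F.
Qed.

Lemma prefix_function_dT (w : word) k i : (k < size w)%N ->
  cvgn (dT_seq (prefix_function w k) i).
Proof.
move=> kw; rewrite prefix_functionE //.
have [x /(eq_vertices_dT_seq i) ->] :=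
  harmonic_Fw attrK (drop k.+1 w) (loop_harmonic loopP (nth ord0 w k)).
rewrite (_ : dT_seq _ i = cst (x (i + 1) - x (i + 2%:R))); first exact: is_cvg_cst.
by apply/funext => n; exact: harmonic_extension_dT.
Qed.

(** The difference of the exact parts equals a difference of elements of the kernel, so it is
    orthogonal to itself. This makes the notions defined by choice independent of the decomposition
    picked. *)
Lemma decomposes_unique om eta eta' Theta Theta' c c' :
  decomposes psi om eta Theta c -> decomposes psi om eta' Theta' c' ->
  [/\ Theta = Theta', c = c' &
      exists a, eq_vertices eta' (fun p => 1 * eta p + cst a p)].
Proof.
move=> [eF T oE cT] [eF' T' oE' cT'].
have gF := in_F_linear attrK (-1) eF eF'.
have dg : d X (fun p => -1 * eta p + eta' p) = Theta - Theta'.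
  rewrite d_linear // scaleN1r.
  have -> : d X eta' = d X eta + Theta - Theta' by rewrite -oE oE' addrK.
  by rewrite -addrA addKr.
have g0 : inner (d X (fun p => -1 * eta p + eta' p))
                (d X (fun p => -1 * eta p + eta' p)) = 0.
  by rewrite {1}dg innerBl T // T' // subrr.
have TT : Theta = Theta'.
  by apply/eqP; rewrite -subr_eq0 -dg; apply/eqP; exact: inner_eq0.
split => //.
  by rewrite -TT in cT'; exact: (loop_coefficient_unique attrK loopP cT cT').
rewrite inner_d // in g0.
exists (-1 * eta (q 0) + eta' (q 0)) => w i.
have := energy0_eq_vertices attrK gF g0 w i; rewrite /cst /= => e.
by rewrite -e; ring.
Qed.

Lemma eq_vertices_shift_dT eta eta' (a : R) (w : word) i :
  eq_vertices eta' (fun p => 1 * eta p + cst a p) ->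
  dT_seq (eta' \o Fw w) i = dT_seq (eta \o Fw w) i.
Proof.
move=> e; apply/funext => n; rewrite /dT_seq /=.
by rewrite -!Fw_cat !e /cst /=; ring.
Qed.

Lemma eq_vertices_shift_d eta eta' (a : R) (w : word) :
  in_F K eta -> in_F K eta' ->
  eq_vertices eta' (fun p => 1 * eta p + cst a p) ->
  d X (eta' \o Fw w) = d X (eta \o Fw w).
Proof.
move=> eF eF' e.
have wF := in_F_Fw attrK w eF; have aF := in_F_cst attrK a.
have e' : eq_vertices (eta' \o Fw w) (fun p => 1 * (eta \o Fw w) p + cst a p).
  by move=> v i /=; rewrite -Fw_cat e.
rewrite (d_eq X attrK (in_F_Fw attrK w eF') (in_F_linear attrK 1 wF aF) e').
by rewrite d_linear // scale1r d_cst // addr0.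
Qed.

Lemma composed_loop_sum_cvg c Theta' (w : word) :
  partial_sum (fun v => c (w ++ v) *: d_loop X psi v) @ totally --> Theta' ->
  partial_sum (fun v => c v *: composed_loop X psi w v) @ totally -->
  \sum_(k < size w) c (take k w) *: d X (prefix_function w k) + Theta'.
Proof.
move=> cT'.
pose strip x := if take (size w) x == w then Some (drop (size w) x) else None.
have stripK : pcancel (cat w) strip.
  by move=> v; rewrite /strip take_size_cat // eqxx drop_size_cat.
have Kstrip : ocancel strip (cat w).
  by move=> x; rewrite /strip; case: eqP => //= {1}<-; rewrite cat_take_drop.
have -> : \sum_(k < size w) c (take k w) *: d X (prefix_function w k) =
    \sum_(x <- proper_prefixes w) c x *: composed_loop X psi w x.
  rewrite sum_proper_prefixes; apply: eq_bigr => k _.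
  by rewrite composed_loop_take.
apply: (totally_cvg_image stripK Kstrip (proper_prefixes_uniq w)).
- exact: cat_notin_proper_prefixes.
- move=> x; rewrite mem_proper_prefixes /strip => nP.
  case: ifP => // /negbT nw _; have [wx|xw] := leqP (size w) (size x).
    by rewrite composed_loop_other // scaler0.
  (* A word shorter than [w] that is not a prefix: the level truncates to 0 and the component at
     [[::]] is the zero function. *)
  rewrite /composed_loop; have -> : ((size x).+1 - size w = 0)%N.
    by apply/eqP; rewrite subn_eq0.
  rewrite /= /compose_family cats0 loop_other ?(d_cst X attrK 0) ?scaler0 //.
  move: nP; rewrite xw /= take_rcons_nth // last_rcons.
  by apply: contra => /eqP /rcons_inj [->].
- rewrite (_ : _ \o _ = (fun v => c (w ++ v) *: d_loop X psi v)) //.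
  by apply/funext => v /=; rewrite composed_loop_cat.
Qed.

(* Along w i^m the i-corner of the loop function is antisymmetric, hence the
   eigenvalue 1/5 of the harmonic rule governs its differences. *)
Lemma dT_loop_branch (w : word) i m :
  dT_loop psi (w ++ nseq m i) w i = 5 ^+ size w * (10 * 5 ^+ m).
Proof.
rewrite /dT_loop /dT_piecewise size_cat size_nseq.
have -> : take (size w + m).+1 (w ++ nseq (size w + m).+1 i) =
    rcons (w ++ nseq m i) i.
  rewrite -addnS take_cat ltnNge leq_addr /= addKn take_nseq ?leq_addl //.
  by rewrite rcons_cat; congr (_ ++ _); elim: m => //= m ->.
rewrite loop_rcons /dT; congr (_ * _).
(* Only from level [m.+1] on do the sample points lie in the cell of w i^(m+1). The shift leaves a
   factor 5^(m+1), and the corner difference 1 - (-1) = 2 completes it to 10 * 5^m. *)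
apply: cvg_lim => //; rewrite -(cvg_shiftn m.+1).
have [x hx] := harmonic_Fw attrK [::] (loop_harmonic loopP i).
rewrite (_ : (fun n => _) = cst (10 * 5 ^+ m)); first exact: cvg_cst.
apply/funext => n; rewrite /dT_seq /loop_piece /=.
have e k : psi i (Fw_inv (w ++ nseq m i) (Fw w (Fw (nseq (n + m.+1) i) (q k)))) =
    harmonic_extension K x (Fw (nseq n i) (q k)).
  by rewrite -hx Fw_inv_cat Fw_K addnS -addSn addnC nseqD Fw_cat Fw_K.
rewrite !e exprD exprS.
have := harmonic_extension_dT attrK x i n; rewrite /dT_seq => dTx.
have x1 : x (i + 1) = 1.
  by rewrite -(harmonic_extension_q attrK) -(hx [::]) -(loop_corner1 loopP i).
have x2 : x (i + 2%:R) = -1.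
  by rewrite -(harmonic_extension_q attrK) -(hx [::]) -(loop_corner2 loopP i).
transitivity (5 * 5 ^+ m * (5 ^+ n *
  (harmonic_extension K x (Fw (nseq n i) (q (i + 1))) -
   harmonic_extension K x (Fw (nseq n i) (q (i + 2%:R)))))); first by ring.
by rewrite dTx x1 x2; ring.
Qed.

Lemma dT_loop_prefix (w : word) i k : (k < size w)%N ->
  dT_loop psi (take k w) w i =
  5 ^+ size w * dT (prefix_function w k) [::] i.
Proof.
move=> kw; rewrite /dT_loop /dT_piecewise size_takel ?(ltnW kw) //.
rewrite takel_cat // /dT /= expr0 mul1r /prefix_function /compose_family cats0.
by [].
Qed.

(** The representative used at F_w q_i belongs to a cell along the infinite word w i i i...; unless
    [x] is a prefix of that word, the loop at [x] is 0 there. *)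
Lemma dT_loop_other (w x : word) i : x \notin proper_prefixes w ->
  x != w ++ nseq (size x - size w) i -> dT_loop psi x w i = 0.
Proof.
move=> nP nx; rewrite /dT_loop /dT_piecewise loop_other.
  rewrite /dT (_ : dT_seq _ i = cst 0) ?lim_cst ?mulr0 //.
  by apply/funext => n; rewrite /dT_seq /= subrr mulr0.
apply: contraNneq nx => e.
have xE : x = take (size x) (w ++ nseq (size x).+1 i).
  have := congr1 (take (size x)) e.
  by rewrite take_takel // => ->; rewrite -cats1 (take_size_cat _ erefl).
have [xw|wx] := ltnP (size x) (size w).
  move: nP; rewrite mem_proper_prefixes xw /= => /negP[].
  by rewrite {2}xE takel_cat // ltnW.
rewrite {1}xE take_cat ifN -?leqNgt // take_nseq //.
by apply: leqW; exact: leq_subr.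
Qed.

(** Stated for any [f] that vanishes with the derivative, so that it covers both the series and the
    series of absolute values. *)
Lemma sum_dT_loop_cvg (V : normedModType R) c (w : word) i
    (f : word -> V) (l : V) :
  (forall x, dT_loop psi x w i = 0 -> f x = 0) ->
  partial_sum (fun m => f (w ++ nseq m i)) @ totally --> l ->
  partial_sum f @ totally --> \sum_(k < size w) f (take k w) + l.
Proof.
move=> f0 fl; rewrite -sum_proper_prefixes.
pose depth x := let m := (size x - size w)%N in
  if x == w ++ nseq m i then Some m else None.
apply: (@totally_cvg_image _ _ _ _ f (fun m => w ++ nseq m i) depth) => //.
- by move=> m; rewrite /depth size_cat size_nseq addKn eqxx.
- by move=> x; rewrite /depth; case: eqP.
- exact: proper_prefixes_uniq.
- by move=> m; exact: cat_notin_proper_prefixes.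
move=> x xP; rewrite /depth; case: ifP => // /negbT nx _.
by apply: f0; exact: dT_loop_other.
Qed.

Lemma tangential_partP om eta Theta c (w : word) i :
  decomposes psi om eta Theta c -> dT_exists eta w i ->
  cvgn (series (fun m => `|c (w ++ nseq m i)| * 5 ^+ m)) ->
  has_tangential_part psi om w i /\
  tangential_part psi om w i = 5 ^+ size w *
    (dT (eta \o Fw w) [::] i +
     \sum_(k < size w) c (take k w) * dT (prefix_function w k) [::] i +
     10 * limn (series (fun m => c (w ++ nseq m i) * 5 ^+ m))).
Proof.
move=> dec eT cabs.
pose a m := c (w ++ nseq m i) * 5 ^+ m.
pose C : R := 5 ^+ size w * 10.
have C0 : 0 <= C by rewrite /C mulr_ge0 // exprn_ge0.
pose f x := c x * dT_loop psi x w i.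
have fE m : f (w ++ nseq m i) = C * a m.
  by rewrite /f dT_loop_branch /C /a; ring.
have abs_a : (fun m => `|a m|) = (fun m => `|c (w ++ nseq m i)| * 5 ^+ m).
  apply/funext => m.
  by rewrite normrM (ger0_norm (exprn_ge0 m (ler0n R 5))).
have ca : cvgn (series (fun m => `|a m|)) by rewrite abs_a.
have seriesC (b : nat -> R) : series (fun m => C * b m) = (fun n => C * series b n).
  by apply/funext => n; rewrite /series /= mulr_sumr.
have cCa : cvgn (series (fun m => `|C * a m|)).
  rewrite (_ : (fun m => _) = (fun m => C * `|a m|)); last first.
    by apply/funext => m; rewrite normrM (ger0_norm C0).
  by rewrite seriesC; apply: is_cvgMr.
have fcvg : partial_sum (f : word -> R^o) @ totally -->
    (\sum_(k < size w) f (take k w) + limn (series (fun m => C * a m)) : R^o).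
  apply: (@sum_dT_loop_cvg R^o c w i) => [x x0|]; first by rewrite /f x0 mulr0.
  under eq_fun do rewrite fE.
  exact: (series_totally_cvg cCa).
have fabs : partial_sum ((fun x => `|f x|) : word -> R^o) @ totally -->
    (\sum_(k < size w) `|f (take k w)| +
     limn (series (fun m => `|C * a m|)) : R^o).
  apply: (@sum_dT_loop_cvg R^o c w i) => [x x0|].
    by rewrite /f x0 mulr0 normr0.
  under eq_fun do rewrite fE.
  apply: (@series_totally_cvg _ (fun m => `|C * a m|)).
  by under eq_fun do rewrite normr_id.
pose t := dT eta w i + (\sum_(k < size w) f (take k w) +
                        limn (series (fun m => C * a m))).
have sumE : sum (f : word -> R^o) = \sum_(k < size w) f (take k w) +
    limn (series (fun m => C * a m)) by exact: (cvg_lim _ fcvg).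
have tP : is_tangential_part psi om w i t.
  exists eta, Theta, c; split=> //; last by rewrite sumE.
  exact: (totally_cvg_summable fabs).
have tE : tangential_part psi om w i = t.
  (* The value picked by [tangential_part] may come with another decomposition; uniqueness
     identifies it with [t]. *)
  have [eta' [Th' [c' [dec' eT' _]]]] :=
    xgetPex 0 (ex_intro (is_tangential_part psi om w i) t tP).
  rewrite -/(tangential_part _ _ _ _) => ->.
  have [_ cc [b e]] := decomposes_unique dec dec'.
  rewrite -cc -/f sumE /t; congr (_ + _).
  by rewrite /dT (eq_vertices_shift_dT w i e).
split; first by exists t.
rewrite tE /t seriesC.
have -> : limn (fun n => C * series a n) = C * limn (series a).
  have ca' : cvgn (series a) by exact: normed_cvg.
  by apply: cvg_lim => //; apply: cvgMr.
rewrite !mulrDr mulr_sumr addrA; congr (_ + _ + _); last by rewrite /C; ring.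
  by rewrite /dT expr0 mul1r.
by apply: eq_bigr => k _; rewrite /f dT_loop_prefix //; ring.
Qed.

Lemma in_F_prefix_sum (b : nat -> R) (g : nat -> plane -> R) u n :
  in_F K u -> (forall k, (k < n)%N -> in_F K (g k)) ->
  in_F K (fun p => \sum_(k < n) b k * g k p + u p) /\
  d X (fun p => \sum_(k < n) b k * g k p + u p) =
    \sum_(k < n) b k *: d X (g k) + d X u.
Proof.
move=> uF; elim: n => [|n IH] gF.
  by under eq_fun do rewrite big_ord0 add0r; rewrite big_ord0 add0r.
have [sF dE] := IH (fun k kn => gF k (ltnW kn)).
have gnF := gF n (ltnSn n).
have -> : (fun p => \sum_(k < n.+1) b k * g k p + u p) =
    (fun p => b n * g n p + (\sum_(k < n) b k * g k p + u p)).
  by apply/funext => p; rewrite big_ord_recr /=; ring.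
split; first exact: in_F_linear.
rewrite d_linear // dE big_ord_recr /= addrA; congr (_ + _); exact: addrC.
Qed.

(** The summands at proper prefixes move into the exact part and the coefficients at words w v
    survive, so [tangential_partP] applies to the composed form as well. *)
Lemma compose_formP om eta Theta c (w : word) :
  decomposes psi om eta Theta c ->
  exists Theta', decomposes psi (compose_form psi om w)
    (fun p => \sum_(k < size w) c (take k w) * prefix_function w k p +
              (eta \o Fw w) p)
    Theta' (fun v => c (w ++ v)).
Proof.
move=> dec; have [eF _ _ cT] := dec.
have [Th' cT'] := loop_sum_shift_cvg attrK loopP w cT.
have sumP := composed_loop_sum_cvg cT'.
set S := \sum_(k < _) _ + _ in sumP.
exists Th'.
have [sF dE] := in_F_prefix_sum (fun k => c (take k w)) (in_F_Fw attrK w eF)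
  (fun k => @prefix_function_in_F w k).
split=> //; first exact: (loop_sum_ker attrK loopP cT').
(* A witness for the set from which [compose_form] chooses; uniqueness of decompositions and of
   limits then identifies the chosen element with it. *)
have nonempty : [set om' : X | exists eta Theta c, decomposes psi om eta Theta c /\
    partial_sum (fun w' => c w' *: composed_loop X psi w w') @ totally
      --> om' - d X (eta \o Fw w)] (S + d X (eta \o Fw w)).
  by exists eta, Theta, c; split; rewrite ?addrK.
have [eta1 [Th1 [c1 [dec1 cv1]]]] := getPex (ex_intro _ _ nonempty).
have [_ cc [b e]] := decomposes_unique dec dec1.
have [eF1 _ _ _] := dec1.
rewrite -cc (eq_vertices_shift_d w eF eF1 e) in cv1.
have SE : S = compose_form psi om w - d X (eta \o Fw w).
  exact: (cvg_unique (@norm_hausdorff _ X) sumP cv1).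
by rewrite dE -[LHS](subrK (d X (eta \o Fw w))) -SE /S addrAC.
Qed.

End Tangential.

Lemma dT_prefix_sum (R : realType) (b : nat -> R) (g : nat -> R^o * R^o -> R)
    (u : R^o * R^o -> R) n i :
  (forall k, (k < n)%N -> cvgn (dT_seq (g k) i)) -> cvgn (dT_seq u i) ->
  dT_seq (fun p => \sum_(k < n) b k * g k p + u p) i @ \oo -->
  \sum_(k < n) b k * limn (dT_seq (g k) i) + limn (dT_seq u i).
Proof.
move=> gc uc.
rewrite (_ : dT_seq _ i =
  (fun m => \sum_(k < n) b k * dT_seq (g k) i m + dT_seq u i m)); last first.
  apply/funext => m; rewrite /dT_seq opprD addrACA mulrDr; congr (_ + _).
  rewrite -sumrB mulr_sumr; apply: eq_bigr => k _; ring.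
apply: cvgD => //; apply: cvg_big => [|k _]; first exact: add_continuous.
by apply: cvgMr; exact: gc.
Qed.

Theorem theorem7p2 (R : realType) (K : set (R^o * R^o)) (X : one_forms K)
    (psi : 'I_3 -> R^o * R^o -> R) (om Theta : X) (eta : R^o * R^o -> R)
    (c : word -> R) (w : word) (i : 'I_3) :
  is_attractor K ->
  is_loop_function K psi ->
  decomposes psi om eta Theta c ->
  dT_exists eta w i ->
  cvgn (series (fun m => `|c (w ++ nseq m i)| * 5 ^+ m)) ->
  [/\ has_tangential_part psi om w i,
      has_tangential_part psi (compose_form psi om w) [::] i,
      tangential_part psi om w i =
        5 ^+ size w * tangential_part psi (compose_form psi om w) [::] i
    & tangential_part psi om w i =
        5 ^+ size w *
          (dT (eta \o Fw w) [::] i +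
           \sum_(k < size w) c (take k w) *
              dT (compose_family k.+1 (loop psi (take k w)) w [::]) [::] i +
           10 * limn (series (fun m => c (w ++ nseq m i) * 5 ^+ m)))].
Proof.
move=> attrK loopP dec eT cabs.
have [ht tE] := tangential_partP attrK loopP dec eT cabs.
have [Th' dec'] := compose_formP attrK loopP w dec.
have etaT := @dT_prefix_sum R (fun k => c (take k w)) (prefix_function psi w)
  (eta \o Fw w) _ i (fun k => @prefix_function_dT _ _ _ attrK loopP w k i) eT.
set eta' := (fun p => _) in dec' etaT.
have eT' : dT_exists eta' [::] i by apply: cvgP; exact: etaT.
have [ht' tE'] := tangential_partP attrK loopP dec' eT' cabs.
split=> //; rewrite tE // tE'; congr (_ * _).
(* The empty word has no proper prefixes; the prefix terms of [w] reappear through the derivative of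
   [eta']. *)
rewrite expr0 mul1r big_ord0 addr0; congr (_ + _).
rewrite /dT /= expr0 !mul1r (cvg_lim _ etaT) // addrC; congr (_ + _).
by apply: eq_bigr => k _; rewrite mul1r.
Qed.
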